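(* Let $n\ge2$, let $\Omega\subset\mathbb{R}^n$ be a bounded open set of class $C^2$ with outer unit normal $\nu$, and let $\beta>0$. If for some $\Lambda$ the problem $$\begin{cases}\min\{|\nabla u|-\Lambda u,\ -\Delta_\infty u\}=0&\text{in }\Omega,\\[2pt] -\min\big\{|\nabla u|-\beta u,\ -\frac{\partial u}{\partial\nu}\big\}=0&\text{on }\partial\Omega\end{cases}$$ admits a non-trivial eigenfunction $u$ (that is, a non-trivial viscosity solution), then $\Lambda\ge\Lambda_\infty$.
   Context: $\Lambda_\infty=\inf\big\{\max\{\|\nabla w\|_{L^\infty(\Omega)},\beta\|w\|_{L^\infty(\partial\Omega)}\}: w\in W^{1,\infty}(\Omega),\ \|w\|_{L^\infty(\Omega)}=1\big\}$. The $\infty$-Laplacian is $\Delta_\infty u=\langle D^2u\,\nabla u,\nabla u\rangle$. Viscosity solutions: for a problem $F(x,u,\nabla u,D^2u)=0$ in $\Omega$, $B(x,u,\nabla u)=0$ on $\partial\Omega$, with $F$ and $B$ continuous functions, a lower semicontinuous function $u$ is a viscosity supersolution if for every $x_0\in\overline\Omega$ and every $\phi\in C^2(\overline\Omega)$ such that $u(x_0)=\phi(x_0)$ and $u-\phi$ has a strict minimum over $\overline\Omega$ at $x_0$, one has: if $x_0\in\Omega$, $F(x_0,\phi(x_0),\nabla\phi(x_0),D^2\phi(x_0))\ge0$; if $x_0\in\partial\Omega$, $\max\{F(x_0,\phi(x_0),\nabla\phi(x_0),D^2\phi(x_0)),\,B(x_0,\phi(x_0),\nabla\phi(x_0))\}\ge0$.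 An upper semicontinuous function $u$ is a viscosity subsolution if for every $x_0\in\overline\Omega$ and $\phi\in C^2(\overline\Omega)$ such that $u(x_0)=\phi(x_0)$ and $u-\phi$ has a strict maximum over $\overline\Omega$ at $x_0$: if $x_0\in\Omega$, $F(x_0,\phi(x_0),\nabla\phi(x_0),D^2\phi(x_0))\le0$; if $x_0\in\partial\Omega$, $\min\{F(x_0,\phi(x_0),\nabla\phi(x_0),D^2\phi(x_0)),\,B(x_0,\phi(x_0),\nabla\phi(x_0))\}\le0$. A continuous function is a viscosity solution if it is both. Here the definition is applied with $F=\min\{|\nabla u|-\Lambda u,-\Delta_\infty u\}$ and $B=-\min\{|\nabla u|-\beta u,-\frac{\partial u}{\partial\nu}\}$.
   Formalization: ''Non-trivial'' is read as: u is positive at some point of the closure of Ω. With mere u ≢ 0 the claim is false: u ≡ −1 solves the problem for Λ = 0, while Λ_∞ > 0. *)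

(* Defs.v *)
From HB Require Import structures.
From mathcomp Require Import all_boot all_order all_algebra.
From mathcomp Require Import all_classical all_reals all_analysis.
Set Implicit Arguments.
Unset Strict Implicit.
Unset Printing Implicit Defensive.
Import Order.TTheory GRing.Theory Num.Theory.
Import numFieldNormedType.Exports.
Local Open Scope classical_set_scope.
Local Open Scope ring_scope.

(** * Euclidean structure and derivatives on R^n *)

(* The library's norm on ['rV_n] is the sup norm: it gives the usual topology,
   but lengths of gradients and unit vectors need the Euclidean norm. *)
Definition dotp (R : realType) (n : nat) (v w : 'rV[R]_n) : R :=
  \sum_(i < n) v ord0 i * w ord0 i.

Definition enorm (R : realType) (n : nat) (v : 'rV[R]_n) : R :=
  Num.sqrt (dotp v v).

Definition partial (R : realType) (n : nat) (i : 'I_n) (f : 'rV[R]_n -> R) :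
    'rV[R]_n -> R :=
  fun x => 'D_(delta_mx ord0 i) f x.

Definition grad (R : realType) (n : nat) (f : 'rV[R]_n -> R) (x : 'rV[R]_n) :
    'rV[R]_n :=
  \row_i partial i f x.

Definition hessian (R : realType) (n : nat) (f : 'rV[R]_n -> R)
    (x : 'rV[R]_n) : 'M[R]_n :=
  \matrix_(i, j) partial i (partial j f) x.

Definition C2_on (R : realType) (n : nat) (U : set 'rV[R]_n)
    (f : 'rV[R]_n -> R) : Prop :=
  [/\ forall x, U x -> differentiable f x,
      forall x i, U x -> differentiable (partial i f) x &
      forall i j, {within U, continuous (partial i (partial j f))}].

Definition smooth (R : realType) (n : nat) (f : 'rV[R]_n -> R) : Prop :=
  forall (s : seq 'I_n) (x : 'rV[R]_n),
    differentiable (foldr (@partial R n) f s) x.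

(** * Open sets of class C^2 and their outer normal *)

Definition bdry (R : realType) (n : nat) (A : set 'rV[R]_n) : set 'rV[R]_n :=
  closure A `\` A°.

Definition local_defining_function (R : realType) (n : nat)
    (Omega U : set 'rV[R]_n) (rho : 'rV[R]_n -> R) : Prop :=
  [/\ C2_on U rho,
      forall x, U x -> grad rho x != 0 &
      Omega `&` U = [set x | rho x < 0] `&` U].

Definition class_C2 (R : realType) (n : nat) (Omega : set 'rV[R]_n) : Prop :=
  forall x, bdry Omega x -> exists (U : set 'rV[R]_n) (rho : 'rV[R]_n -> R),
    [/\ open U, U x & local_defining_function Omega U rho].

Definition outer_unit_normal (R : realType) (n : nat) (Omega : set 'rV[R]_n)
    (nu : 'rV[R]_n -> 'rV[R]_n) : Prop :=
  forall x, bdry Omega x ->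
  forall (U : set 'rV[R]_n) (rho : 'rV[R]_n -> R),
    open U -> U x -> local_defining_function Omega U rho ->
    nu x = (enorm (grad rho x))^-1 *: grad rho x.

(** * Lebesgue measure on R^n *)

(* The measure lives on [n.-tuple R], which the library equips with its product
   (Borel) sigma-algebra, and is the n-fold product of the one-dimensional
   Lebesgue measure; [rv_of_tuple] carries it to ['rV[R]_n]. *)
Section tuple_measure.
Context (R : realType).
Local Open Scope ereal_scope.
Local Notation RM := (measurableTypeR R).

Definition tcons (n : nat) (p : RM * n.-tuple RM) : n.+1.-tuple RM :=
  [the n.+1.-tuple RM of p.1 :: p.2].

Lemma measurable_tcons (n : nat) : measurable_fun [set: _] (@tcons n).
Proof. exact: measurable_cons measurable_fst measurable_snd. Qed.

Variables (n : nat) (mu : {sigma_finite_measure set (n.-tuple RM) -> \bar R}).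

Definition cons_measure (A : set (n.+1.-tuple RM)) : \bar R :=
  ((@lebesgue_measure R) \x mu) (@tcons n @^-1` A).

Let cons_measure0 : cons_measure set0 = 0.
Proof. by rewrite /cons_measure preimage_set0 measure0. Qed.

Let cons_measure_ge0 A : 0 <= cons_measure A.
Proof. exact: measure_ge0. Qed.

Let measurable_tcons_preimage A : measurable A -> measurable (@tcons n @^-1` A).
Proof. by move=> mA; rewrite -[_ @^-1` _]setTI; exact: measurable_tcons. Qed.

Let cons_measure_sigma_additive : semi_sigma_additive cons_measure.
Proof.
move=> F mF tF mUF; rewrite /cons_measure preimage_bigcup.
apply: measure_semi_sigma_additive.
- by move=> k; exact: measurable_tcons_preimage.
- move/trivIsetP : tF => tF; apply/trivIsetP => i j _ _ ij.
  by rewrite -preimage_setI tF// preimage_set0.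
- by rewrite -preimage_bigcup; exact: measurable_tcons_preimage.
Qed.

HB.instance Definition _ := isMeasure.Build _ _ _ cons_measure
  cons_measure0 cons_measure_ge0 cons_measure_sigma_additive.

Let cons_measure_sigma_finite : sigma_finite setT cons_measure.
Proof.
have /sigma_finiteP[F [TF ndF Foo]] := sigma_finiteT (@lebesgue_measure R).
have /sigma_finiteP[G [TG ndG Goo]] := sigma_finiteT mu.
pose g (t : n.+1.-tuple RM) : RM * n.-tuple RM := (thead t, [tuple of behead t]).
have mg : measurable_fun [set: _] g.
  apply: measurable_fun_pair; first exact: measurable_tnth.
  exact: measurable_behead.
have tK p : g (tcons p) = p.
  by case: p => a t; rewrite /g theadE; congr pair; exact: val_inj.
exists (fun k => g @^-1` (F k `*` G k)).
  rewrite -preimage_bigcup -[LHS](preimage_setT g); congr (g @^-1` _).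
  rewrite -setXTT TF TG predeqE => -[x y]; split.
    move=> [/= [i _ Fix] [j _ Gjy]]; exists (maxn i j) => //; split.
    - by move: x Fix; exact/subsetPset/ndF/leq_maxl.
    - by move: y Gjy; exact/subsetPset/ndG/leq_maxr.
  by move=> [k _ []/= ? ?]; split; exists k.
move=> k; have [mF Fk] := Foo k; have [mG Gk] := Goo k; split.
  by rewrite -[_ @^-1` _]setTI; apply: mg => //; exact: measurableX.
rewrite /cons_measure (_ : _ @^-1` _ = F k `*` G k); last first.
  by apply/funext => p; exact: (congr1 (F k `*` G k) (tK p)).
by rewrite product_measure1E// lte_mul_pinfty// ge0_fin_numE.
Qed.

HB.instance Definition _ := Measure_isSigmaFinite.Build _ _ _ cons_measure
  cons_measure_sigma_finite.

End tuple_measure.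

Fixpoint lebesgue_tuple (R : realType) (n : nat) :
    {sigma_finite_measure set (n.-tuple (measurableTypeR R)) -> \bar R} :=
  match n with
  | 0 => @dirac _ _ [tuple] R
  | m.+1 => cons_measure (lebesgue_tuple R m)
  end.

Definition rv_of_tuple (R : realType) (n : nat)
    (t : n.-tuple (measurableTypeR R)) : 'rV[R]_n :=
  \row_i tnth t i.

(** * The space W^{1,infty} and Lambda_infty *)

Definition Linf_norm (R : realType) (n : nat) (Omega : set 'rV[R]_n)
    (f : 'rV[R]_n -> R) : \bar R :=
  Lnorm (lebesgue_tuple R n) +oo%E
    (fun t => ((f \_ Omega) (rv_of_tuple t))%:E).

Definition Linf (R : realType) (n : nat) (Omega : set 'rV[R]_n)
    (f : 'rV[R]_n -> R) : Prop :=
  measurable_fun (@rv_of_tuple R n @^-1` Omega)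
    (fun t => f (rv_of_tuple t) : measurableTypeR R) /\
  (Linf_norm Omega f < +oo)%E.

Definition test_function (R : realType) (n : nat) (Omega : set 'rV[R]_n)
    (phi : 'rV[R]_n -> R) : Prop :=
  smooth phi /\
  exists K : set 'rV[R]_n,
    [/\ compact K, K `<=` Omega & forall x, ~ K x -> phi x = 0].

Definition weak_gradient (R : realType) (n : nat) (Omega : set 'rV[R]_n)
    (w : 'rV[R]_n -> R) (g : 'rV[R]_n -> 'rV[R]_n) : Prop :=
  forall phi, test_function Omega phi -> forall i : 'I_n,
    \int[lebesgue_tuple R n]_(t in @rv_of_tuple R n @^-1` Omega)
      (w (rv_of_tuple t) * partial i phi (rv_of_tuple t)) =
    - \int[lebesgue_tuple R n]_(t in @rv_of_tuple R n @^-1` Omega)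
      (g (rv_of_tuple t) ord0 i * phi (rv_of_tuple t)).

Definition W1inf (R : realType) (n : nat) (Omega : set 'rV[R]_n)
    (w : 'rV[R]_n -> R) (g : 'rV[R]_n -> 'rV[R]_n) : Prop :=
  [/\ Linf Omega w,
      forall i, Linf Omega (fun x => g x ord0 i) &
      weak_gradient Omega w g].

(* For 0 < k, the k-dimensional Hausdorff measure of N vanishes.  On a C^2
   hypersurface and with k = n - 1 these are the null sets of the surface
   measure; no mesh condition is needed, since a small sum forces small radii. *)
Definition hausdorff_null (R : realType) (n k : nat) (N : set 'rV[R]_n) :
    Prop :=
  forall eps : R, 0 < eps ->
  exists (c : nat -> 'rV[R]_n) (r : nat -> R),
    [/\ forall j, 0 < r j,
        N `<=` \bigcup_j ball (c j) (r j) &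
        (\sum_(0 <= j <oo) ((r j) ^+ k)%:E <= eps%:E)%E].

Definition Linf_norm_bdry (R : realType) (n : nat) (Omega : set 'rV[R]_n)
    (f : 'rV[R]_n -> R) : \bar R :=
  ereal_inf [set c : \bar R | exists2 N : set 'rV[R]_n,
    hausdorff_null n.-1 N &
    forall x, bdry Omega x -> ~ N x -> (`|f x|%:E <= c)%E].

(* A class in W^{1,infty}(Omega) is represented by its continuous extension to
   the closure, so that its trace is the restriction to the boundary; g is its
   weak gradient, which is unique almost everywhere. *)
Definition Lambda_infty (R : realType) (n : nat) (Omega : set 'rV[R]_n)
    (beta : R) : \bar R :=
  ereal_inf [set m : \bar R |
    exists (w : 'rV[R]_n -> R) (g : 'rV[R]_n -> 'rV[R]_n),
      [/\ W1inf Omega w g,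
          {within closure Omega, continuous w},
          Linf_norm Omega w = 1%E &
          m = maxe (Linf_norm Omega (fun x => enorm (g x)))
                   (beta%:E * Linf_norm_bdry Omega w)%E]].

(** * Viscosity solutions *)

Section viscosity.
Context (R : realType) (n : nat).
Variable Omega : set 'rV[R]_n.
Variable F : 'rV[R]_n -> R -> 'rV[R]_n -> 'M[R]_n -> R.
Variable B : 'rV[R]_n -> R -> 'rV[R]_n -> R.
Implicit Types u phi : 'rV[R]_n -> R.

Definition lsc_on (A : set 'rV[R]_n) (u : 'rV[R]_n -> R) : Prop :=
  lower_semicontinuous ((fun x => (u x)%:E) : subspace A -> \bar R).

Definition usc_on (A : set 'rV[R]_n) (u : 'rV[R]_n -> R) : Prop :=
  lsc_on A (fun x => - u x).

Definition touches_below u phi (x0 : 'rV[R]_n) : Prop :=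
  u x0 = phi x0 /\
  forall x, closure Omega x -> x != x0 -> u x0 - phi x0 < u x - phi x.

Definition touches_above u phi (x0 : 'rV[R]_n) : Prop :=
  u x0 = phi x0 /\
  forall x, closure Omega x -> x != x0 -> u x - phi x < u x0 - phi x0.

(* C^2(closure Omega) is read as restrictions of C^2 functions on R^n. *)
Definition viscosity_supersolution u : Prop :=
  lsc_on (closure Omega) u /\
  forall x0 phi, closure Omega x0 -> C2_on setT phi ->
    touches_below u phi x0 ->
    (Omega x0 -> 0 <= F x0 (phi x0) (grad phi x0) (hessian phi x0)) /\
    (bdry Omega x0 ->
       0 <= Num.max (F x0 (phi x0) (grad phi x0) (hessian phi x0))
                    (B x0 (phi x0) (grad phi x0))).

Definition viscosity_subsolution u : Prop :=
  usc_on (closure Omega) u /\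
  forall x0 phi, closure Omega x0 -> C2_on setT phi ->
    touches_above u phi x0 ->
    (Omega x0 -> F x0 (phi x0) (grad phi x0) (hessian phi x0) <= 0) /\
    (bdry Omega x0 ->
       Num.min (F x0 (phi x0) (grad phi x0) (hessian phi x0))
               (B x0 (phi x0) (grad phi x0)) <= 0).

Definition viscosity_solution u : Prop :=
  [/\ {within closure Omega, continuous u},
      viscosity_supersolution u & viscosity_subsolution u].

End viscosity.

(** * The infinity-eigenvalue problem with Robin boundary condition *)

Definition infty_laplacian_symbol (R : realType) (n : nat) (p : 'rV[R]_n)
    (X : 'M[R]_n) : R :=
  dotp (p *m X^T) p.

Definition eigen_F (R : realType) (n : nat) (Lambda : R) (x : 'rV[R]_n) (r : R)
    (p : 'rV[R]_n) (X : 'M[R]_n) : R :=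
  Num.min (enorm p - Lambda * r) (- infty_laplacian_symbol p X).

Definition robin_B (R : realType) (n : nat) (nu : 'rV[R]_n -> 'rV[R]_n)
    (beta : R) (x : 'rV[R]_n) (r : R) (p : 'rV[R]_n) : R :=
  - Num.min (enorm p - beta * r) (- dotp p (nu x)).

(* For this problem "u is not identically 0" is too weak a reading of
   "non-trivial".  A constant c < 0 has vanishing gradient and Hessian, so
   eigen_F = min (- Lambda * c) 0 = 0 and robin_B = - min (- beta * c) 0 = 0:
   it solves the problem for every 0 <= Lambda, in particular for Lambda = 0,
   although Lambda_infty is positive.  The equation with the single minimum is
   the one satisfied by first eigenfunctions where they are positive. *)
Definition positive_somewhere (R : realType) (n : nat) (A : set 'rV[R]_n)
    (u : 'rV[R]_n -> R) : Prop :=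
  exists2 x, A x & 0 < u x.

(* Main.v *)
Require Import Defs.
From mathcomp Require Import all_boot all_order all_algebra.
From mathcomp Require Import all_classical all_reals all_analysis.
From mathcomp Require Import measurable_realfun ess_sup_inf ring lra.
Import Order.TTheory GRing.Theory Num.Theory.
Import numFieldNormedType.Exports.
Local Open Scope classical_set_scope.
Local Open Scope ring_scope.

(** Let [M > 0] be the maximum of [u] over the closure of [Omega], attained at
    [x1], let [L = max Lambda 0], and let [d] be the infimum of the distances
    from [x1] to the points outside the closure.  Both [Lambda] and
    [Lambda_infty] are compared with [1 / (1 / beta + d)].

    Lower bound for [Lambda] ([exterior_distance_bound]).  Take a point [y]
    outside the closure and, at [y], the vertex of a cone of slope [K > L * M],
    bent slightly so that it is strictly infinity-superharmonic and has slope in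
    [(L * M, K]] over the closure.  Where [u] minus this cone is maximal, the
    cone touches [u] from above, up to a constant.  An interior contact point
    would contradict the equation, since the slope exceeds [Lambda * u] there
    and the infinity-Laplacian is negative; at a boundary contact point [z] the
    only way out is [beta * u z <= K].  Hence [u z <= K / beta], and comparing
    the values at [x1] and [z] gives [M <= K * (1 / beta + |x1 - y|)].  Letting
    [K] decrease to [L * M] yields [1 <= L * (1 / beta + |x1 - y|)] for every
    exterior [y], so [1 <= Lambda * (1 / beta + d)].

    Upper bound for [Lambda_infty] ([Lambda_infty_le_radius]).  A boundary point
    of a domain of class C^2 is a limit of exterior points
    ([bdry_limit_of_exterior]), so it is at distance at least [d] from [x1].
    The truncated cone [1 / beta + max (d - |x - x1|) 0] therefore has slope at
    most 1, equals [1 / beta] on the boundary, and has maximum [1 / beta + d],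
    at [x1]; after normalization it is a competitor of value
    [1 / (1 / beta + d)].  Rounding its vertex and its edge makes it smooth at
    an arbitrarily small cost, so that its weak gradient is its gradient.

    Checking that a C^1 function is a competitor ([Lambda_infty_le_C1]) needs
    two facts about the measure: integration by parts against test functions
    ([weak_gradient_C1], from Fubini and the fundamental theorem of calculus in
    one coordinate), and positivity on nonempty open sets
    ([lebesgue_tuple_open_gt0]), which turns the maximum at [x1] into an
    essential supremum. *)

Set Implicit Arguments.
Unset Strict Implicit.
Unset Printing Implicit Defensive.

(** * Derivatives of radial functions *)

Lemma chain_partial (R : realType) (n : nat) (f : 'rV[R]_n -> R) (h : R -> R)
    (d : R) (x : 'rV[R]_n) :
  differentiable f x -> is_derive (f x) 1 h d ->
  differentiable (h \o f) x /\
  forall i, partial i (h \o f) x = d * partial i f x.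
Proof.
move=> df dh.
have dh' : differentiable h (f x) by apply/derivable1_diffP; case: dh.
have dhf : differentiable (h \o f) x by exact: differentiable_comp.
split=> // i; rewrite /partial !deriveE// diff_comp//=.
have lin c : 'd h (f x) c = c * 'd h (f x) 1.
  by rewrite -[in LHS](mulr1 c) -[c * 1]/(c *: 1) linearZ.
by rewrite lin -(@deriveE _ _ _ h _ 1 dh') (@derive_val _ _ _ _ _ _ _ dh) mulrC.
Qed.

(** Radial functions are written as functions of the squared distance, which
    is a polynomial, so that they are differentiable at the center too. *)
Definition sqdist (R : realType) (n : nat) (a x : 'rV[R]_n) : R :=
  dotp (x - a) (x - a).

Lemma sqdistE (R : realType) (n : nat) (a : 'rV[R]_n) :
  sqdist a = \sum_(i < n) (fun x : 'rV[R]_n => x ord0 i - a ord0 i) ^+ 2.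
Proof.
apply/funext => x; rewrite fct_sumE /sqdist /dotp.
by apply: eq_bigr => i _; rewrite !mxE exprfctE expr2.
Qed.

Lemma partial_coord (R : realType) (n : nat) (i j : 'I_n) (c : R) (x : 'rV[R]_n) :
  differentiable (fun y : 'rV[R]_n => y ord0 j - c) x /\
  partial i (fun y : 'rV[R]_n => y ord0 j - c) x = (i == j)%:R.
Proof.
have d : differentiable (fun y : 'rV[R]_n => y ord0 j - c) x.
  by apply: differentiableB => //; exact: differentiable_coord.
split=> //; rewrite /partial.
apply: cvg_lim => //=; apply: cvg_near_cst; near=> h.
have h0 : h != 0 by near: h; exact: nbhs_dnbhs_neq.
rewrite /= !mxE eqxx/= eq_sym.
rewrite [X in h^-1 *: X](_ : _ = h * (i == j)%:R); last by ring.
by rewrite scalerA mulVf// scale1r.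
Unshelve. all: by end_near. Qed.

Lemma differentiable_sqdist (R : realType) (n : nat) (a x : 'rV[R]_n) :
  differentiable (sqdist a) x.
Proof.
rewrite sqdistE; apply: differentiable_sum => i; apply: differentiableX.
by have [] := partial_coord i i (a ord0 i) x.
Qed.

Lemma partial_sqdist (R : realType) (n : nat) (a x : 'rV[R]_n) (i : 'I_n) :
  partial i (sqdist a) x = 2 * (x ord0 i - a ord0 i).
Proof.
rewrite /partial sqdistE.
have dd (j : 'I_n) : is_derive x (delta_mx ord0 i : 'rV[R]_n)
    ((fun x : 'rV[R]_n => x ord0 j - a ord0 j) ^+ 2)
    (2 * (x ord0 j - a ord0 j) * (i == j)%:R).
  have [d p] := partial_coord i j (a ord0 j) x.
  apply: DeriveDef; first by apply/diff_derivable/differentiableX.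
  have dF := @is_diffX _ _ _ _ 1 x (differentiableP d).
  rewrite deriveE; last exact: differentiableX.
  by rewrite (@diff_val _ _ _ _ _ _ _ dF) /= -p /partial deriveE.
rewrite (@derive_val _ _ _ _ _ _ _ (is_derive_sum dd)).
rewrite (bigD1 i)//= eqxx mulr1 big1 ?addr0// => j ji.
by rewrite eq_sym (negbTE ji) mulr0.
Qed.

Lemma partialD (R : realType) (n : nat) (f g : 'rV[R]_n -> R) (x : 'rV[R]_n)
    (i : 'I_n) :
  differentiable f x -> differentiable g x ->
  partial i (f \+ g) x = partial i f x + partial i g x.
Proof.
by move=> df dg; rewrite /partial [LHS]deriveD//; exact: diff_derivable.
Qed.

Lemma partialM (R : realType) (n : nat) (f g : 'rV[R]_n -> R) (x : 'rV[R]_n)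
    (i : 'I_n) :
  differentiable f x -> differentiable g x ->
  partial i (f \* g) x = f x * partial i g x + g x * partial i f x.
Proof.
by move=> df dg; rewrite /partial [LHS]deriveM//; exact: diff_derivable.
Qed.

Lemma sqdist_ge0 (R : realType) (n : nat) (a x : 'rV[R]_n) : 0 <= sqdist a x.
Proof. by apply: sumr_ge0 => i _; rewrite -expr2 sqr_ge0. Qed.

Lemma continuous_sqdist (R : realType) (n : nat) (a : 'rV[R]_n) :
  continuous (sqdist a).
Proof.
by move=> x; apply: differentiable_continuous; exact: differentiable_sqdist.
Qed.

Lemma radial_partial (R : realType) (n : nat) (a : 'rV[R]_n) (h h1 : R -> R) :
  (forall s : R, 0 <= s -> is_derive s 1 h (h1 s)) ->
  (forall x, differentiable (h \o sqdist a) x) /\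
  forall i, partial i (h \o sqdist a) =
    (h1 \o sqdist a) \* (fun x => 2 * (x ord0 i - a ord0 i)).
Proof.
move=> dh.
have P x := chain_partial (differentiable_sqdist a x) (dh _ (sqdist_ge0 a x)).
split=> [x|i]; first by have [] := P x.
by apply/funext => x; have [_ ->] := P x; rewrite partial_sqdist.
Qed.

(** Two derivatives of [h] on the half-line [0 <= s] suffice, because the squared
    distance takes no other values.  The Hessian is a multiple of the identity
    plus a rank-one matrix, which is why the infinity-Laplacian of a radial
    function reduces to [infty_laplacian_radial]. *)
Lemma radial_C2 (R : realType) (n : nat) (a : 'rV[R]_n) (h h1 h2 : R -> R) :
  (forall s : R, 0 <= s -> is_derive s 1 h (h1 s)) ->
  (forall s : R, 0 <= s -> is_derive s 1 h1 (h2 s)) ->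
  (forall s : R, 0 <= s -> {for s, continuous h2}) ->
  C2_on setT (h \o sqdist a) /\
  forall x, grad (h \o sqdist a) x = (2 * h1 (sqdist a x)) *: (x - a) /\
    hessian (h \o sqdist a) x = (2 * h1 (sqdist a x))%:M +
      (4 * h2 (sqdist a x)) *: ((x - a)^T *m (x - a)).
Proof.
move=> dh dh1 ch2.
have [D1 P1] := radial_partial a dh; have [D2 P2] := radial_partial a dh1.
have aff (i j : 'I_n) x :
    differentiable (fun y : 'rV[R]_n => 2 * (y ord0 j - a ord0 j)) x /\
    partial i (fun y : 'rV[R]_n => 2 * (y ord0 j - a ord0 j)) x =
      2 * (i == j)%:R.
  have [d p] := partial_coord i j (a ord0 j) x.
  split; first exact: (@differentiableZ _ _ _ _ 2 _ d).
  by rewrite -p /partial; apply: deriveZ; exact: diff_derivable.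
have P i j : partial i (partial j (h \o sqdist a)) = fun x =>
    h1 (sqdist a x) * (2 * (i == j)%:R) + 2 * (x ord0 j - a ord0 j) *
      (h2 (sqdist a x) * (2 * (x ord0 i - a ord0 i))).
  apply/funext => x; have [d p] := aff i j x.
  by rewrite P1 partialM// p P2.
split.
  split=> // [x i _|i j].
    rewrite P1; apply: differentiableM; first exact: D2.
    by have [] := aff i i x.
  apply: continuous_subspaceT => x; rewrite P.
  have cs : {for x, continuous (sqdist a)} by exact: continuous_sqdist.
  have c1 : (h1 \o sqdist a) y @[y --> x] --> h1 (sqdist a x).
    exact/differentiable_continuous.
  have c2 : (h2 \o sqdist a) y @[y --> x] --> h2 (sqdist a x).
    exact: (continuous_comp cs (ch2 _ (sqdist_ge0 a x))).
  have c3 k : (fun y : 'rV[R]_n => 2 * (y ord0 k - a ord0 k)) y @[y --> x] -->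
      2 * (x ord0 k - a ord0 k).
    by have [/differentiable_continuous] := aff k k x.
  exact: (cvgD (cvgM c1 (cvg_cst _)) (cvgM (c3 j) (cvgM c2 (c3 i)))).
move=> x; split.
  by apply/rowP => i; rewrite !mxE P1 /=; ring.
apply/matrixP => i j; rewrite !mxE P big_ord1 !mxE mulr_natr -mulr_natr.
by case: (i == j); rewrite /= ?mulr1n ?mulr0n; ring.
Qed.

Lemma C2_onD (R : realType) (n : nat) (f g : 'rV[R]_n -> R) :
  C2_on setT f -> C2_on setT g ->
  C2_on setT (f \+ g) /\
  forall x, grad (f \+ g) x = grad f x + grad g x /\
    hessian (f \+ g) x = hessian f x + hessian g x.
Proof.
move=> [df df1 cf] [dg dg1 cg].
have P i : partial i (f \+ g) = partial i f \+ partial i g.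
  by apply/funext => x; apply: partialD; [exact: df|exact: dg].
have P2 i j : partial i (partial j (f \+ g)) =
    partial i (partial j f) \+ partial i (partial j g).
  by apply/funext => x; rewrite P; apply: partialD; [exact: df1|exact: dg1].
split; last first.
  by move=> x; split; [apply/rowP => i|apply/matrixP => i j];
     rewrite !mxE (P, P2).
split=> [x _|x i _|i j].
- by apply: differentiableD; [exact: df|exact: dg].
- by rewrite P; apply: differentiableD; [exact: df1|exact: dg1].
- by rewrite P2 => x; apply: cvgD; [exact: cf|exact: cg].
Qed.

(** * The barrier cone *)

Lemma is_derive_sqrt_shift (R : realType) (eta s : R) : 0 < eta + s ->
  is_derive s 1 (fun t : R => Num.sqrt (eta + t)) (2 * Num.sqrt (eta + s))^-1.
Proof.
move=> s0; rewrite -[X in is_derive _ _ _ X]mulr1.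
have d1 : is_derive s (1 : R) (fun t : R => eta + t) 1.
  rewrite -[X in is_derive _ _ _ X]add0r.
  exact: (is_deriveD (is_derive_cst _ _ _) (is_derive_id _ _)).
exact: (@is_derive1_comp _ Num.sqrt _ _ _ _ (is_derive1_sqrt s0) d1).
Qed.

Lemma is_derive_barrier (R : realType) (K eta delta c s : R) : 0 < eta + s ->
  is_derive s (1 : R) (fun t => K * (Num.sqrt (eta + t) - delta * t) + c)
    (K * ((2 * Num.sqrt (eta + s))^-1 - delta)).
Proof.
move=> s0; have d := is_derive_sqrt_shift s0.
have d1 := is_deriveB d (is_deriveZ delta (is_derive_id s (1 : R))).
have d2 := is_deriveD (is_deriveZ K d1) (is_derive_cst c s (1 : R)).
apply: (@is_derive_eq _ _ _ _ _ _ _ _ d2).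
by rewrite addr0 -!/(_ * _) -[delta *: 1]/(delta * 1) mulr1.
Qed.

Lemma is_derive_barrier1 (R : realType) (K eta delta s : R) : 0 < eta + s ->
  is_derive s (1 : R) (fun t => K * ((2 * Num.sqrt (eta + t))^-1 - delta))
    (- (K / (4 * Num.sqrt (eta + s) ^+ 3))).
Proof.
move=> s0; have d := is_derive_sqrt_shift s0.
have q0 : 0 < Num.sqrt (eta + s) by rewrite sqrtr_gt0.
have d1 : is_derive s (1 : R) (fun t => 2 * Num.sqrt (eta + t))
    (2 * (2 * Num.sqrt (eta + s))^-1) by exact: is_deriveZ.
have n0 : 2 * Num.sqrt (eta + s) != 0 by rewrite mulf_neq0// gt_eqF.
have d2 := @is_deriveV _ (fun t => 2 * Num.sqrt (eta + t)) s _ 1 n0 d1.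
have d3 := is_deriveZ K (is_deriveB d2 (is_derive_cst delta s (1 : R))).
apply: (@is_derive_eq _ _ _ _ _ _ _ _ d3).
rewrite subr0 -!/(_ * _).
move: q0 n0; set q := Num.sqrt _ => q0 n0.
rewrite -[_ *: (2 * _)]/(_ * _) -[K *: _]/(K * _) /GRing.scale/=.
by field; rewrite gt_eqF.
Qed.

(** A cone with vertex [y] and slope about [K]: the parameter [eta] rounds the
    vertex, which would make the profile convex, and the quadratic term
    restores strict concavity in the radial direction away from [y]. *)
Definition barrier (R : realType) (n : nat) (K eta delta : R)
    (y x : 'rV[R]_n) : R :=
  K * (Num.sqrt (eta + sqdist y x) - delta * sqdist y x).

Lemma dotpZ (R : realType) (n : nat) (c : R) (v w : 'rV[R]_n) :
  dotp (c *: v) w = c * dotp v w.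
Proof.
by rewrite /dotp mulr_sumr; apply: eq_bigr => i _; rewrite !mxE mulrA.
Qed.

Lemma dotpZr (R : realType) (n : nat) (c : R) (v w : 'rV[R]_n) :
  dotp v (c *: w) = c * dotp v w.
Proof.
by rewrite /dotp mulr_sumr; apply: eq_bigr => i _; rewrite !mxE mulrCA.
Qed.

Lemma enormZ (R : realType) (n : nat) (c : R) (v : 'rV[R]_n) :
  enorm (c *: v) = `|c| * enorm v.
Proof.
rewrite /enorm dotpZ dotpZr mulrA -expr2 sqrtrM ?sqr_ge0//.
by rewrite sqrtr_sqr.
Qed.

Lemma dotp_mulmx (R : realType) (n : nat) (v w : 'rV[R]_n) :
  v *m w^T = (dotp v w)%:M.
Proof.
apply/matrixP => i j; rewrite !mxE !ord1 eqxx mulr1n.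
by apply: eq_bigr => k _; rewrite !mxE.
Qed.

Lemma infty_laplacian_radial (R : realType) (n : nat) (A A' B : R) (v : 'rV[R]_n) :
  infty_laplacian_symbol (A *: v) (A'%:M + B *: (v^T *m v)) =
  A ^+ 2 * dotp v v * (A' + B * dotp v v).
Proof.
rewrite /infty_laplacian_symbol linearD/= linearZ/= tr_scalar_mx trmx_mul trmxK.
rewrite mulmxDr mul_mx_scalar -scalemxAr -scalemxAl mulmxA dotp_mulmx.
rewrite mul_scalar_mx !scalerA -scalerDl dotpZ dotpZr.
ring.
Qed.

Lemma sqdist_eq0 (R : realType) (n : nat) (a x : 'rV[R]_n) :
  (sqdist a x == 0) = (x == a).
Proof.
apply/idP/eqP => [|->]; last first.
  by rewrite /sqdist subrr /dotp big1// => i _; rewrite mxE mul0r.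
rewrite /sqdist /dotp psumr_eq0 => [/allP h|i _]; last by rewrite -expr2 sqr_ge0.
apply/rowP => i; have := h i (mem_index_enum i).
by rewrite /= -expr2 sqrf_eq0 !mxE subr_eq0 => /eqP.
Qed.

(** Adding [K * delta / 2] times the squared distance to [z] makes the contact
    strict without changing the gradient at [z], and uses only half of the
    concavity provided by [delta].  With [eta < delta * q ^+ 3] the
    infinity-Laplacian of the resulting test function is then negative at [z],
    so the subsolution property can only hold through one of the two gradient
    terms. *)
Lemma touching_barrier (R : realType) (n : nat) (Omega : set 'rV[R]_n)
    (nu : 'rV[R]_n -> 'rV[R]_n) (beta Lambda : R) (u : 'rV[R]_n -> R)
    (K eta delta : R) (y z : 'rV[R]_n) :
  open Omega ->
  viscosity_subsolution Omega (eigen_F Lambda) (robin_B nu beta) u ->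
  closure Omega z -> 0 < K -> 0 < delta -> 0 < eta -> z != y ->
  (forall x, closure Omega x ->
    u x - barrier K eta delta y x <= u z - barrier K eta delta y z) ->
  let q := Num.sqrt (eta + sqdist y z) in
  let A := K * (q^-1 - 2 * delta) in
  0 < A -> eta < delta * q ^+ 3 ->
  A * enorm (z - y) <= Lambda * u z \/ beta * u z <= A * enorm (z - y).
Proof.
move=> oO [_ usub] cz K0 d0 e0 zy maxz q A A0 edq.
have S0 : 0 < sqdist y z by rewrite lt_def sqdist_eq0 zy sqdist_ge0.
have esp (s : R) : 0 <= s -> 0 < eta + s by move=> ?; rewrite ltr_wpDr.
have q0 : 0 < q by rewrite sqrtr_gt0 esp// ltW.
have q2 : q ^+ 2 = eta + sqdist y z by rewrite sqr_sqrtr// ltW// esp// ltW.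
pose c := u z - barrier K eta delta y z.
pose h (s : R) := K * (Num.sqrt (eta + s) - delta * s) + c.
pose h1 (s : R) := K * ((2 * Num.sqrt (eta + s))^-1 - delta).
pose h2 (s : R) := - (K / (4 * Num.sqrt (eta + s) ^+ 3)).
pose e := K * delta / 2.
have dh (s : R) : 0 <= s -> is_derive s 1 h (h1 s).
  by move=> s0; apply: is_derive_barrier; exact: esp.
have dh1 (s : R) : 0 <= s -> is_derive s 1 h1 (h2 s).
  by move=> s0; apply: is_derive_barrier1; exact: esp.
have ch2 (s : R) : 0 <= s -> {for s, continuous h2}.
  move=> s0; have sq : Num.sqrt (eta + t) @[t --> s] --> Num.sqrt (eta + s).
    have /derivable1_diffP/differentiable_continuous // :=
      @ex_derive _ _ _ _ _ _ _ (is_derive_sqrt_shift (esp _ s0)).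
  have q30 : 4 * Num.sqrt (eta + s) ^+ 3 != 0.
    by rewrite mulf_neq0// expf_neq0// gt_eqF// sqrtr_gt0 esp.
  have sq3 : Num.sqrt (eta + t) ^+ 3 @[t --> s] --> Num.sqrt (eta + s) ^+ 3.
    by rewrite !exprS expr0 mulr1; exact: (cvgM sq (cvgM sq sq)).
  exact: (cvgN (cvgM (cvg_cst K) (cvgV q30 (cvgM (cvg_cst (4 : R)) sq3)))).
have [C2h Eh] := radial_C2 y dh dh1 ch2.
have dg (s : R) : 0 <= s -> is_derive s 1 (fun s => e * s) e.
  move=> _; rewrite -[X in is_derive _ _ _ X]mulr1.
  exact: (is_deriveZ e (is_derive_id s (1 : R))).
have dg1 (s : R) : 0 <= s -> is_derive s (1 : R) (fun=> e) 0.
  by move=> _; exact: is_derive_cst.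
have cg2 (s : R) : 0 <= s -> {for s, continuous (fun=> 0 : R)}.
  by move=> _; exact: cvg_cst.
have [C2g Eg] := radial_C2 z dg dg1 cg2.
have [C2hg Ehg] := C2_onD C2h C2g.
pose phi := (h \o sqdist y) \+ ((fun s => e * s) \o sqdist z).
have phiz : phi z = u z.
  rewrite /phi /= /h -/(barrier K eta delta y z).
  have /eqP -> : sqdist z z == 0 by rewrite sqdist_eq0.
  by rewrite mulr0 addr0 /c addrC subrK.
have touch : touches_above Omega u phi z.
  split=> // x cx xz; rewrite phiz subrr subr_lt0.
  rewrite /phi /= /h -/(barrier K eta delta y x) /c.
  have : 0 < e * sqdist z x.
    rewrite mulr_gt0//; first by rewrite /e !mulr_gt0.
    by rewrite lt_def sqdist_eq0 xz sqdist_ge0.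
  have := maxz _ cx; lra.
have [FO FB] := usub z phi cz C2hg touch.
have sz0 : sqdist z z = 0 by apply/eqP; rewrite sqdist_eq0.
have gradE : grad phi z = A *: (z - y).
  have [-> _] := Ehg z; have [-> _] := Eh z; have [-> _] := Eg z.
  rewrite subrr scaler0 addr0; congr (_ *: _).
  by rewrite /h1 /A -/q; field; rewrite gt_eqF.
have hessE : hessian phi z = (K * (q^-1 - delta))%:M
    + (- (K / q ^+ 3)) *: ((z - y)^T *m (z - y)).
  have [_ ->] := Ehg z; have [_ ->] := Eh z; have [_ ->] := Eg z.
  rewrite mulr0 scale0r addr0 addrAC -raddfD/=; congr (_%:M + _ *: _).
    by rewrite /h1 -/q /e; field; rewrite gt_eqF.
  by rewrite /h2 -/q; field; rewrite gt_eqF.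
have nE : enorm (grad phi z) = A * enorm (z - y).
  by rewrite gradE enormZ gtr0_norm.
have lap : infty_laplacian_symbol (grad phi z) (hessian phi z) < 0.
  rewrite gradE hessE infty_laplacian_radial -/(sqdist y z).
  rewrite pmulr_rlt0; last by rewrite mulr_gt0// exprn_gt0.
  have -> : K * (q^-1 - delta) + - (K / q ^+ 3) * sqdist y z =
      K * ((eta - delta * q ^+ 3) / q ^+ 3).
    have -> : sqdist y z = q ^+ 2 - eta by rewrite q2 addrC addKr.
    by field; rewrite gt_eqF.
  rewrite pmulr_rlt0// pmulr_llt0 ?invr_gt0 ?exprn_gt0//.
  by rewrite subr_lt0.
have Fcase : eigen_F Lambda z (phi z) (grad phi z) (hessian phi z) <= 0 ->
    A * enorm (z - y) <= Lambda * u z.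
  rewrite /eigen_F ge_min phiz nE => /orP[|]; first by rewrite subr_le0.
  by rewrite oppr_le0 leNgt lap.
have [zO|zO] := pselect (Omega z); first by left; exact/Fcase/FO.
have /FB : bdry Omega z by split=> // /interior_subset.
rewrite ge_min => /orP[/Fcase|]; first by left.
rewrite /robin_B oppr_le0 le_min => /andP[+ _]; right.
by rewrite -nE -phiz -subr_ge0.
Qed.

(** Used to choose the rounding parameter of the barrier, which must be small
    compared with three quantities fixed before it. *)
Lemma exists_small (R : realType) (a b c : R) : 0 < a -> 0 < b -> 0 < c ->
  exists t : R, [/\ 0 < t, t < a, t < b & t ^+ 2 < c].
Proof.
move=> a0 b0 c0; near (0 : R)^'+ => t; exists t.
have t0 : 0 < t by near: t; exact: nbhs_right_gt.
have ta : t < a by near: t; exact: nbhs_right_lt.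
have tb : t < b by near: t; exact: nbhs_right_lt.
have tc : t < c by near: t; exact: nbhs_right_lt.
have t1 : t < 1 by near: t; exact: nbhs_right_lt.
split=> //; rewrite expr2 (le_lt_trans _ tc)// ler_piMr ?ltW//.
Unshelve. all: by end_near. Qed.

Lemma enorm_sqrt (R : realType) (n : nat) (x y : 'rV[R]_n) :
  enorm (x - y) = Num.sqrt (sqdist y x).
Proof. by []. Qed.

Lemma continuous_dist (R : realType) (n : nat) (y : 'rV[R]_n) :
  continuous (fun x : 'rV[R]_n => enorm (x - y)).
Proof.
move=> x.
exact: (continuous_comp (@continuous_sqdist _ _ y x) (@sqrt_continuous R _)).
Qed.

Lemma continuous_barrier (R : realType) (n : nat) (K eta delta : R) (y : 'rV[R]_n) :
  continuous (barrier K eta delta y).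
Proof.
move=> x; have cs := @continuous_sqdist _ _ y x.
have ce : eta + sqdist y t @[t --> x] --> eta + sqdist y x.
  exact: (cvgD (cvg_cst eta) cs).
have cq : Num.sqrt (eta + sqdist y t) @[t --> x] -->
    Num.sqrt (eta + sqdist y x).
  by apply: continuous_cvg ce; exact: sqrt_continuous.
exact: (cvgM (cvg_cst K) (cvgB cq (cvgM (cvg_cst delta) cs))).
Qed.

Lemma bounded_closure (R : realType) (V : normedModType R) (A : set V) :
  bounded_set A -> bounded_set (closure A).
Proof.
move=> [M [Mr bM]]; exists M; split=> // N /bM AN x cx.
have cN : closed [set y : V | `|y| <= N].
  apply: (@preimage_closed _ _ (fun y : V => `|y|) _ _ (@closed_le _ N)) => y _.
  exact: norm_continuous.
by move/closure_id: cN => cN; move: cx => /(closureS AN); rewrite -cN.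
Qed.

(** Comparison of [u] with barriers whose vertex is outside the closure.  Arguing
    by contradiction leaves room for a slope [K] strictly between [L * M] and
    [M / (1 / beta + |x1 - y|)].  At the contact point [z] one gets
    [u z > K / beta > 0]; positivity gives [Lambda * u z <= L * M] even when
    [Lambda] is negative. *)
Lemma exterior_distance_bound (R : realType) (n : nat) (Omega : set 'rV[R]_n)
    (nu : 'rV[R]_n -> 'rV[R]_n) (beta Lambda : R) (u : 'rV[R]_n -> R)
    (x1 y : 'rV[R]_n) :
  open Omega -> bounded_set Omega -> 0 < beta ->
  {within closure Omega, continuous u} ->
  viscosity_subsolution Omega (eigen_F Lambda) (robin_B nu beta) u ->
  closure Omega x1 -> (forall x, closure Omega x -> u x <= u x1) -> 0 < u x1 ->
  ~ closure Omega y ->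
  1 <= Num.max Lambda 0 * (beta^-1 + enorm (x1 - y)).
Proof.
move=> oO bO b0 cu su cx1 maxu ux10 cy.
set M := u x1 in ux10 *; set L := Num.max Lambda 0; set E := enorm (x1 - y).
have L0 : 0 <= L by rewrite le_max lexx orbT.
have ib0 : 0 < beta^-1 by rewrite invr_gt0.
have E0 : 0 <= E by exact: sqrtr_ge0.
have bE0 : 0 < beta^-1 + E by rewrite ltr_pwDl.
rewrite leNgt; apply/negP => LbE.
have [K LK KM] : exists2 K, L * M < K & K * (beta^-1 + E) < M.
  have : L * M < M / (beta^-1 + E).
    by rewrite ltr_pdivlMr// mulrAC gtr_pMl.
  move=> /midf_lt[]; set K := (_ / 2) => h1 h2; exists K => //.
  by rewrite -ltr_pdivlMr.
have K0 : 0 < K by rewrite (le_lt_trans _ LK)// mulr_ge0// ltW.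
have compO : compact (closure Omega).
  apply: bounded_closed_compact; last exact: closed_closure.
  exact: bounded_closure.
have neO : closure Omega !=set0 by exists x1.
have cd : {within closure Omega, continuous (fun x => enorm (x - y))}.
  by apply: continuous_subspaceT => x; exact: continuous_dist.
have [xm /set_mem cxm minr] := EVT_min_rV neO compO cd.
have [xM /set_mem cxM maxr] := EVT_max_rV neO compO cd.
set r0 := enorm (xm - y) in minr; set D := enorm (xM - y) in maxr.
have neq x : closure Omega x -> x != y.
  by move=> cx; apply: contra_not_neq cy => <-.
have dgt0 x : closure Omega x -> 0 < enorm (x - y).
  by move=> cx; rewrite enorm_sqrt sqrtr_gt0 lt_def sqdist_eq0 neq// sqdist_ge0.
have r00 : 0 < r0 by exact: dgt0.
have D0 : 0 < D by exact: dgt0.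
(* [k] is the relative loss of slope that can be afforded: the bending costs at
   most [2 * delta * D = k / 2] and the rounding at most [t / r0 < k / 4]. *)
pose k := 1 - L * M / K.
have k0 : 0 < k by rewrite subr_gt0 ltr_pdivrMr// mul1r.
have k1 : k <= 1 by rewrite gerBl divr_ge0 ?mulr_ge0// ltW.
pose delta := k / 4 / D.
have delta0 : 0 < delta by rewrite !divr_gt0.
(* [K * g] is the margin left in the comparison of the values at [x1] and [z]. *)
pose g := M / K - E - beta^-1.
have g0 : 0 < g.
  by rewrite /g -addrA -opprD subr_gt0 [E + _]addrC ltr_pdivlMr// mulrC.
have [t [t0 tr tg td]] : exists t, [/\ 0 < t, t < r0 * k / 4, t < g &
    t ^+ 2 < delta * r0 ^+ 3].
  apply: exists_small => //; first by rewrite divr_gt0 ?mulr_gt0.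
  by rewrite mulr_gt0 ?exprn_gt0.
pose psi := barrier K (t ^+ 2) delta y.
have cpsi : {within closure Omega, continuous (u \- psi)}.
  move=> x; apply: cvgB; first exact: cu.
  by apply: (continuous_subspaceT (@continuous_barrier _ _ K _ delta y)).
have [z /set_mem cz maxz] := EVT_max_rV neO compO cpsi.
have maxz' x : closure Omega x -> u x - psi x <= u z - psi z.
  by move=> cx; exact/maxz/mem_set.
(* [q] is squeezed between the distance [r] and [r + t], where [t ^+ 2] is the
   rounding parameter. *)
have sqE x : sqdist y x = enorm (x - y) ^+ 2.
  by rewrite enorm_sqrt sqr_sqrtr// sqdist_ge0.
have qle x : Num.sqrt (t ^+ 2 + sqdist y x) <= enorm (x - y) + t.
  have n0 : 0 <= enorm (x - y) by exact: sqrtr_ge0.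
  have nt0 : 0 <= enorm (x - y) + t by rewrite addr_ge0// ltW.
  rewrite -[leRHS](ger0_norm nt0) -sqrtr_sqr ler_wsqrtr//.
  rewrite sqE sqrrD; have : 0 <= enorm (x - y) * t by rewrite mulr_ge0// ltW.
  lra.
have qge x : enorm (x - y) <= Num.sqrt (t ^+ 2 + sqdist y x).
  by rewrite enorm_sqrt ler_wsqrtr// lerDr sqr_ge0.
have rz : r0 <= enorm (z - y) by exact/minr/mem_set.
have Rz : enorm (z - y) <= D by exact/maxr/mem_set.
set r := enorm (z - y) in rz Rz.
set q := Num.sqrt (t ^+ 2 + sqdist y z).
have rq : r <= q by exact: qge.
have qr : q <= r + t by exact: qle.
have q0 : 0 < q by apply: lt_le_trans rq; exact: lt_le_trans rz.
have dD : delta * D = k / 4 by rewrite /delta divfK// gt_eqF.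
have psi0 : 0 <= psi z.
  rewrite /psi /barrier mulr_ge0 ?ltW// -/q subr_gt0 sqE -/r.
  apply: lt_le_trans rq; rewrite expr2 mulrA gtr_pMl ?(lt_le_trans r00)//.
  have : delta * r <= delta * D by rewrite ler_pM2l.
  lra.
have psi1 : psi x1 <= K * (E + t).
  rewrite /psi /barrier ler_pM2l// (le_trans _ (qle x1))//.
  by rewrite gerBl mulr_ge0 ?sqdist_ge0// ltW.
have uz : K / beta < u z.
  have KtM : K * (E + t) + K / beta < M.
    rewrite -mulrDr -ltr_pdivlMl// mulrC; move: tg; rewrite /g; lra.
  have := maxz' _ cx1; rewrite -/M; lra.
have uz0 : 0 < u z by rewrite (lt_trans _ uz)// divr_gt0.
pose A := K * (q^-1 - 2 * delta).
have Ar : L * M < A * r.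
  have -> : A * r = K * (r / q - 2 * (delta * r)) by rewrite /A; ring.
  rewrite -ltr_pdivrMl//.
  have dr : delta * r <= k / 4 by rewrite -dD ler_pM2l.
  have rqt : 1 - k / 4 <= r / q.
    rewrite ler_pdivlMr//.
    have : k / 4 * r0 <= k / 4 * q.
      by rewrite ler_pM2l ?divr_gt0// (le_trans rz).
    move: tr; lra.
  have -> : K^-1 * (L * M) = 1 - k by rewrite /k; ring.
  lra.
have A0 : 0 < A.
  rewrite -(pmulr_lgt0 _ (lt_le_trans r00 rz)).
  by rewrite (le_lt_trans _ Ar)// mulr_ge0// ltW.
have AK : A * r <= K.
  have -> : A * r = K * (r / q - 2 * (delta * r)) by rewrite /A; ring.
  have r_ge0 : 0 <= r by exact: sqrtr_ge0.
  rewrite ger_pMr// (@le_trans _ _ (r / q))//; last by rewrite ler_pdivrMr// mul1r.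
  by rewrite gerBl mulr_ge0// mulr_ge0// ltW.
have edq : t ^+ 2 < delta * q ^+ 3.
  rewrite (lt_le_trans td)// ler_pM2l// lerXn2r ?nnegrE//; try exact: ltW.
  exact: le_trans rz rq.
have t20 : 0 < t ^+ 2 by rewrite exprn_gt0.
have [] := touching_barrier oO su cz K0 delta0 t20 (neq _ cz) maxz' A0 edq.
- rewrite -/q -/A -/r leNgt => /negP; apply.
  apply: le_lt_trans Ar; apply: (@le_trans _ _ (L * u z)).
    by rewrite ler_pM2r// le_max lexx.
  by rewrite ler_wpM2l// maxu.
- rewrite -/q -/A -/r leNgt => /negP; apply.
  by apply: le_lt_trans AK _; rewrite mulrC -ltr_pdivrMr.
Qed.

(** * Exterior points near the boundary *)

(** By continuity [rho] stays positive near [y], and there [Omega] is the set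
    where [rho] is negative. *)
Lemma defining_function_gt0_exterior (R : realType) (n : nat)
    (Omega U : set 'rV[R]_n) (rho : 'rV[R]_n -> R) (y : 'rV[R]_n) :
  open U -> local_defining_function Omega U rho -> U y -> 0 < rho y ->
  ~ closure Omega y.
Proof.
move=> oU [[drho _ _] _ eqU] Uy rhoy cy.
have crho : rho x @[x --> y] --> rho y.
  exact: differentiable_continuous (drho _ Uy).
have nU : nbhs y (U `&` [set x | 0 < rho x]).
  apply: filterI; first exact: open_nbhs_nbhs.
  exact: (crho _ (lt_nbhsr rhoy)).
have [x [Ox [Ux rx]]] := cy _ nU.
have OUx : (Omega `&` U) x by [].
by move: OUx; rewrite eqU => -[/= + _]; rewrite ltNge ltW.
Qed.

(** A defining function vanishes at a boundary point and has a nonzero partial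
    derivative there, so it takes positive values along a coordinate line
    arbitrarily close to the point; these belong to exterior points. *)
Lemma bdry_limit_of_exterior (R : realType) (n : nat) (Omega : set 'rV[R]_n)
    (y : 'rV[R]_n) :
  open Omega -> class_C2 Omega -> bdry Omega y -> closure (~` closure Omega) y.
Proof.
move=> oO C2 by_; have [U [rho [oU Uy ldf]]] := C2 y by_.
case: by_ => cy iy.
have Oy : ~ Omega y.
  by move=> Oy; apply: iy; exact: open_nbhs_nbhs.
have [[drho _ _] grad0 eqU] := ldf.
have rho0 : rho y = 0.
  apply/eqP; rewrite eq_le; apply/andP; split.
    rewrite leNgt; apply/negP => ry.
    exact: (defining_function_gt0_exterior oU ldf Uy ry cy).
  rewrite leNgt; apply/negP => ry; apply: Oy.
  by have [] : (Omega `&` U) y by rewrite eqU.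
have [i di] : exists i, partial i rho y != 0.
  apply/not_existsP => p0; move/eqP: (grad0 _ Uy); apply.
  apply/rowP => i; rewrite !mxE.
  by have /negP := p0 i; rewrite negbK => /eqP.
set d := partial i rho y in di.
pose e : 'rV[R]_n := delta_mx ord0 i.
have qd : h^-1 *: (rho (h *: e + y) - rho y) @[h --> 0^'] --> d.
  by apply: (@diff_derivable _ _ _ _ _ e); exact: drho.
move=> B By.
have nB : \forall h \near (0 : R), (B `&` U) (h *: e + y).
  have ch : h *: e + y @[h --> (0 : R)] --> y.
    rewrite -[X in _ --> X]add0r -[X in X + _](scale0r e).
    by apply: cvgD; [apply: cvgZr_tmp; exact: cvg_id|exact: cvg_cst].
  by apply: ch; apply: filterI => //; exact: open_nbhs_nbhs.
have d2 : 0 < d * d by rewrite -expr2 exprn_even_gt0.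
have qd0 : \forall h \near (0 : R), h != 0 ->
    0 < d * (h^-1 *: (rho (h *: e + y) - rho y)).
  have dqd : d * (h^-1 *: (rho (h *: e + y) - rho y)) @[h --> (0 : R)^'] --> d * d.
    exact: cvgM (cvg_cst d) qd.
  exact: dqd _ (lt_nbhsr d2).
have td : t * d @[t --> (0 : R)] --> (0 : R).
  by rewrite -[X in _ --> X](mul0r d); apply: cvgMr_tmp; exact: cvg_id.
have Qt : \forall t \near (0 : R), (t * d != 0 ->
      0 < d * ((t * d)^-1 *: (rho ((t * d) *: e + y) - rho y))) /\
    (B `&` U) ((t * d) *: e + y) by exact: td _ (filterI qd0 nB).
(* Moving by [t * d] with [t > 0] gives the displacement the sign of the
   derivative [d]. *)
near (0 : R)^'+ => t.
have t0 : 0 < t by near: t; exact: nbhs_right_gt.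
have [q [By' Uy']] : (t * d != 0 ->
      0 < d * ((t * d)^-1 *: (rho ((t * d) *: e + y) - rho y))) /\
    (B `&` U) ((t * d) *: e + y).
  by near: t; apply: cvg_within; exact: Qt.
exists ((t * d) *: e + y); split=> //.
apply: (defining_function_gt0_exterior oU ldf Uy').
have := q (mulf_neq0 (lt0r_neq0 t0) di).
rewrite rho0 subr0 -[_ *: _]/(_ * _) mulrA invfM mulrCA mulfV// mulr1.
by rewrite pmulr_rgt0// invr_gt0.
Unshelve. all: by end_near. Qed.

(** * Integration by parts for the product Lebesgue measure *)

Lemma measurable_cube (R : realType) (n : nat) (c : 'I_n -> R) (r : R) :
  measurable [set t : n.-tuple (measurableTypeR R) |
    forall i, ball (c i) r (tnth t i)].
Proof.
rewrite (_ : [set _ | _] = \bigcap_(i in [set: 'I_n])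
    ((fun t : n.-tuple (measurableTypeR R) => tnth t i) @^-1` ball (c i) r)).
  apply: fin_bigcap_measurable => // i _.
  rewrite -[_ @^-1` _]setTI; apply: (@measurable_tnth _ (measurableTypeR R)) => //.
  by apply: open_measurable; exact: ball_open.
by apply/seteqP; split => t /= h i => [_|]; exact: h.
Qed.

Lemma preimage_ballE (R : realType) (n : nat) (c : 'rV[R]_n) (r : R) : 0 < r ->
  @rv_of_tuple R n @^-1` ball c r =
  [set t | forall i, ball (c ord0 i) r (tnth t i)].
Proof.
move=> r0; apply/seteqP; split => t /=.
  by case=> _ h i; have := h ord0 i; rewrite mxE.
by move=> h; split=> // j i; rewrite ord1 mxE.
Qed.

(** An open set is the union of the balls with rational center and radius
    [1 / (k + 1)] that it contains; these are countably many, and their preimages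
    are cubes. *)
Lemma measurable_rv_of_tuple_open (R : realType) (n : nat) (U : set 'rV[R]_n) :
  open U -> measurable (@rv_of_tuple R n @^-1` U).
Proof.
move=> oU.
pose D := [set p : 'rV[rat]_n * nat |
  ball (map_mx ratr p.1 : 'rV[R]_n) p.2.+1%:R^-1 `<=` U].
pose F (p : 'rV[rat]_n * nat) : set (n.-tuple (measurableTypeR R)) :=
  if p \in D
  then @rv_of_tuple R n @^-1` (ball (map_mx ratr p.1 : 'rV[R]_n) p.2.+1%:R^-1)
  else set0.
rewrite (_ : _ @^-1` U = \bigcup_p F p); last first.
  apply/seteqP; split => [t /= Ut|t [p _]]; last first.
    by rewrite /F; case: ifPn => // /set_mem Dp /Dp.
  have /nbhs_ballP[e /= e0 eU] : nbhs (rv_of_tuple t) U.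
    exact: open_nbhs_nbhs.
  have [k ke] : exists k, k.+1%:R^-1 < e / 2.
    have := near_infty_natSinv_lt (PosNum (divr_gt0 e0 (ltr0n R 2))).
    by move=> [k _ /(_ k (leqnn k))]; exists k.
  have k0 : (0 : R) < k.+1%:R^-1 by rewrite invr_gt0.
  have q_ex (i : 'I_n) : exists q : rat, ball (tnth t i) k.+1%:R^-1 (ratr q : R).
    have [x [Bx [q _ qx]]] := @dense_rat R (ball (tnth t i) k.+1%:R^-1)
      (ex_intro _ (tnth t i) (ballxx _ k0)) (ball_open _ _).
    by exists q; rewrite qx.
  have [q qP] := choice q_ex.
  pose c : 'rV[R]_n := map_mx ratr (\row_i q i).
  have cE i : c ord0 i = ratr (q i) by rewrite !mxE.
  have ct : ball c k.+1%:R^-1 (rv_of_tuple t).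
    by split=> // j i; rewrite ord1 cE mxE; exact: ball_sym.
  exists (\row_i q i, k) => //; rewrite /F ifT//.
  apply/mem_set => x /= cx; apply: eU.
  apply: (@ball_split _ _ c) => //.
    by apply: le_ball (ltW ke) _ _; exact: ball_sym.
  by apply: le_ball (ltW ke) _ cx.
apply: countable_bigcupT_measurable; first exact: countableP.
move=> p; rewrite /F; case: ifPn => // _.
by rewrite preimage_ballE ?invr_gt0//; exact: measurable_cube.
Qed.

Lemma measurable_continuous (R : realType) (n : nat) (f : 'rV[R]_n -> R) :
  continuous f ->
  measurable_fun [set: n.-tuple (measurableTypeR R)]
    (fun t => f (rv_of_tuple t) : measurableTypeR R).
Proof.
move=> cf; apply: (@measurability _ _ _ (measurableTypeR R) _ _ _
  (@RGenOpens.measurableE R)).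
move=> _ [_ [a [b ->]] <-]; rewrite setTI.
rewrite -[X in measurable X]/(@rv_of_tuple R n @^-1` (f @^-1` `]a, b[%classic)).
apply: measurable_rv_of_tuple_open.
by apply: open_comp => [x _|]; [exact: cf|exact: interval_open].
Qed.

Lemma lebesgue_tuple_cube (R : realType) (n : nat) (c : 'I_n -> R) (r : R) :
  0 < r ->
  lebesgue_tuple R n [set t | forall i, ball (c i) r (tnth t i)] =
  ((r *+ 2) ^+ n)%:E.
Proof.
move=> r0; elim: n c => [|n IH] c.
  have tA : [tuple] \in [set t : 0.-tuple (measurableTypeR R) |
      forall i, ball (c i) r (tnth t i)] by apply/mem_set => -[].
  by rewrite /= diracE tA expr0.
rewrite [LHS]/= /cons_measure.
rewrite (_ : _ @^-1` _ = ball (c ord0) r `*`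
   [set t : n.-tuple (measurableTypeR R) |
     forall i, ball (c (lift ord0 i)) r (tnth t i)]); last first.
  apply/seteqP; split => -[x t] /= h.
    by split=> [|i]; [have := h ord0|have := h (lift ord0 i); rewrite tnthS].
  case: h => hx ht i; case: (unliftP ord0 i) => [j ->|-> //].
  by rewrite tnthS; exact: ht.
rewrite product_measure1E; last exact: measurable_cube; last first.
  by apply: open_measurable; exact: ball_open.
rewrite IH [X in (X * _)%E](lebesgue_measure_ball (c ord0) (ltW r0)).
by rewrite -EFinM exprS.
Qed.

Lemma bounded_support_integrable d (T : measurableType d) (R : realType)
    (mu : {measure set T -> \bar R}) (f : T -> R) (A : set T) (C : R) :
  measurable A -> (mu A < +oo)%E -> measurable_fun setT f ->
  (forall x, `|f x| <= C) -> (forall x, ~ A x -> f x = 0) ->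
  mu.-integrable setT (EFin \o f).
Proof.
move=> mA Afin mf fC f0.
have iA : mu.-integrable A (EFin \o f).
  apply: measurable_bounded_integrable => //; first exact: measurable_funTS.
  exists C; split; first exact: num_real.
  by move=> M CM x _; exact: le_trans (fC x) (ltW CM).
have fA : EFin \o f = (EFin \o f) \_ A.
  apply/funext => x; rewrite patchE; case: ifPn => // /negP xA.
  by rewrite /= f0// => /mem_set.
by rewrite fA -integrable_mkcond.
Qed.

(** The fundamental theorem of calculus on an interval beyond which [h]
    vanishes. *)
Lemma integral_derivative_compact (R : realType) (h g : R -> R) (M : R) :
  (forall s : R, is_derive s 1 h (g s)) -> continuous g ->
  (forall s, M <= `|s| -> h s = 0 /\ g s = 0) ->
  (\int[@lebesgue_measure R]_s (g s)%:E = 0)%E.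
Proof.
move=> dh cg supp; pose M' := `|M| + 1.
have M'0 : 0 < M' by rewrite ltr_wpDl.
have MM' : M <= M' by rewrite (le_trans (ler_norm M))// lerDl.
have far s : ~ `[- M', M']%classic s -> g s = 0.
  move=> sM; have [] // := supp s; rewrite leNgt; apply/negP => sM'; apply: sM.
  by rewrite /= in_itv/= -ler_norml ltW// (lt_le_trans sM').
have -> : (fun s => (g s)%:E) = (fun s => (g s)%:E) \_ `[- M', M'].
  apply/funext => s; rewrite patchE; case: ifPn => // /negP sM.
  by rewrite far// => /mem_set.
rewrite -integral_mkcond.
have ch : continuous h.
  move=> s; apply: differentiable_continuous; apply/derivable1_diffP.
  by have [] := dh s.
have NM : - M' < M' by rewrite gtrN.
rewrite (@continuous_FTC2 _ g h (- M') M' NM).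
- have [-> _] : h M' = 0 /\ g M' = 0 by apply: supp; rewrite gtr0_norm.
  have [-> _] : h (- M') = 0 /\ g (- M') = 0.
    by apply: supp; rewrite normrN gtr0_norm.
  by rewrite subee.
- exact: continuous_subspaceT.
- split; first by move=> s _; have [] := dh s.
  + by apply: cvg_at_right_filter; exact: ch.
  + by apply: cvg_at_left_filter; exact: ch.
- by move=> s _; rewrite derive1E (@derive_val _ _ _ _ _ _ _ (dh s)).
Qed.

(** The line through [t] parallel to the [i]-th axis.  Working with it on tuples,
    rather than with vectors, matches the recursive construction of the
    measure. *)
Definition update_coord (T : Type) (n : nat) (i : 'I_n) (t : n.-tuple T) (s : T) :
    n.-tuple T :=
  [tuple if j == i then s else tnth t j | j < n].

Lemma update_coord_ord0 (T : Type) (n : nat) (t : n.-tuple T) (x s : T) :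
  update_coord ord0 [tuple of x :: t] s = [tuple of s :: t].
Proof.
apply: eq_from_tnth => j; rewrite tnth_mktuple.
case: (unliftP ord0 j) => [k ->|->]; last by rewrite eqxx.
by rewrite eq_sym (negbTE (neq_lift _ _)) !tnthS.
Qed.

Lemma update_coord_lift (T : Type) (n : nat) (i : 'I_n) (t : n.-tuple T) (x s : T) :
  update_coord (lift ord0 i) [tuple of x :: t] s =
  [tuple of x :: update_coord i t s].
Proof.
apply: eq_from_tnth => j; rewrite tnth_mktuple.
case: (unliftP ord0 j) => [k ->|->]; last by rewrite (negbTE (neq_lift _ _)).
by rewrite !tnthS tnth_mktuple (inj_eq lift_inj).
Qed.

(** By induction on the dimension: Fubini is used with the first coordinate as
    the inner variable when it is the one of the derivative, where the
    one-dimensional case applies, and as the outer variable otherwise, where the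
    induction hypothesis does. *)
Lemma integral_coord_derivative (R : realType) (n : nat) (i : 'I_n)
    (H G : n.-tuple (measurableTypeR R) -> R) (C M : R) :
  0 < M -> measurable_fun setT (G : _ -> measurableTypeR R) ->
  (forall t, `|G t| <= C) ->
  (forall t j, M <= `|tnth t j| -> H t = 0 /\ G t = 0) ->
  (forall t (s : R), is_derive s 1 (fun s => H (update_coord i t s) : R)
    (G (update_coord i t s))) ->
  (forall t, continuous (fun s : R => G (update_coord i t s) : R)) ->
  (\int[lebesgue_tuple R n]_t (G t)%:E = 0)%E.
Proof.
move=> M0; elim: n i H G => [[]//|n IH] i H G mG GC supp dH cG.
pose mu := lebesgue_tuple R n.
have mT : measurable_fun setT (@tcons R n) by exact: measurable_tcons.
have mGT : measurable_fun setT (fun p => G (tcons p) : measurableTypeR R).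
  exact: (measurableT_comp mG mT).
pose B := [set p : measurableTypeR R * n.-tuple (measurableTypeR R) |
  ball (0 : R) M p.1 /\
  forall j, ball (0 : R) M (tnth p.2 j)].
have BX : B = ball (0 : R) M `*`
    [set t : n.-tuple (measurableTypeR R) | 
      forall j, ball (0 : R) M (tnth t j)] by [].
have mB1 : measurable (ball (0 : R) M : set (measurableTypeR R)).
  by apply: open_measurable; exact: ball_open.
have mB : measurable B.
  by rewrite BX; apply: measurableX => //; exact: measurable_cube.
have Bfin : ((@lebesgue_measure R \x mu) B < +oo)%E.
  rewrite BX product_measure1E//; last exact: measurable_cube.
  rewrite lebesgue_tuple_cube// [X in (X * _)%E](lebesgue_measure_ball 0 (ltW M0)).
  by rewrite -EFinM ltry.
have notball (x : R) : ~ ball (0 : R) M x -> M <= `|x|.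
  by move=> /negP; rewrite /ball/= sub0r normrN -leNgt.
have iG : (@lebesgue_measure R \x mu)%E.-integrable setT
    (EFin \o (fun p => G (tcons p))).
  apply: (bounded_support_integrable mB Bfin mGT (fun p => GC _)) => p nB.
  have [x0|x0] := pselect (ball (0 : R) M p.1).
    have [j xj] : exists j, ~ ball (0 : R) M (tnth p.2 j).
      by apply/existsNP => h; apply: nB; split.
    have [] // := supp (tcons p) (lift ord0 j).
    by rewrite tnthS; exact: notball.
  by have [] // := supp (tcons p) ord0; exact: notball.
have -> : (\int[lebesgue_tuple R n.+1]_t (G t)%:E =
    \int[(@lebesgue_measure R \x mu)]_p (G (tcons p))%:E)%E.
  transitivity (\int[pushforward (@lebesgue_measure R \x mu)%E
    (@tcons R n)]_t (G t)%:E)%E.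
    exact: eq_measure_integral.
  rewrite (integral_pushforward mT _ iG)//.
  exact/measurable_EFinP.
case: (unliftP ord0 i) => [k ik|i0].
  rewrite -(integral12_prod_meas1 iG) integral0_eq// => x _.
  apply: (IH k (fun t => H [tuple of x :: t]) (fun t => G [tuple of x :: t])).
  - by apply: (measurableT_comp mG); apply: measurable_cons.
  - by [].
  - by move=> t j Mj; apply: (supp _ (lift ord0 j)); rewrite tnthS.
  - move=> t s; have := dH [tuple of x :: t] s.
    rewrite ik update_coord_lift; congr is_derive; apply/funext => s'.
    by rewrite update_coord_lift.
  - move=> t; have := cG [tuple of x :: t]; rewrite ik.
    by under eq_fun do rewrite update_coord_lift.
rewrite -(integral21_prod_meas1 iG) integral0_eq// => t _.
apply: (@integral_derivative_compact _ (fun s => H [tuple of s :: t])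
  (fun s => G [tuple of s :: t]) M).
- move=> s; have := dH [tuple of (0 : R) :: t] s.
  by rewrite i0 update_coord_ord0; under eq_fun do rewrite update_coord_ord0.
- have := cG [tuple of (0 : R) :: t]; rewrite i0.
  by under eq_fun do rewrite update_coord_ord0.
- by move=> s Ms; apply: (supp _ ord0).
Qed.

Lemma compact_support_bounded (R : realType) (n : nat) (K : set 'rV[R]_n)
    (f : 'rV[R]_n -> R) :
  compact K -> continuous f -> (forall x, ~ K x -> f x = 0) ->
  exists C, forall x, `|f x| <= C.
Proof.
move=> cK cf f0.
have /compact_bounded[C [_ fC]] : compact (f @` K).
  by apply: continuous_compact => //; exact: continuous_subspaceT.
exists (`|C| + 1) => x; have [Kx|/f0 ->] := pselect (K x); last first.
  by rewrite normr0 addr_ge0.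
by apply: fC; [rewrite ltr_pwDr// ler_norm|exists x].
Qed.

Lemma compact_sub_cube (R : realType) (n : nat) (K : set 'rV[R]_n) :
  compact K -> exists2 M : R, 0 < M &
    forall t i, K (rv_of_tuple t) -> `|tnth t i| < M.
Proof.
move=> /compact_bounded[M [_ KM]]; exists (`|M| + 2) => [|t i Kt].
  by rewrite ltr_wpDl.
have := KM (`|M| + 1) _ _ Kt; rewrite ltr_pwDr ?ler_norm// => /(_ isT) tM.
have MM : `|M| + 1 < `|M| + 2 by rewrite ltrD2l ltr1n.
apply: le_lt_trans MM; apply: le_trans tM.
rewrite -[X in _ <= X]/(mx_norm _) mx_normrE.
by apply: le_trans (le_bigmax _ _ (ord0, i)); rewrite /= mxE.
Qed.

Lemma compact_support_integrable (R : realType) (n : nat) (K : set 'rV[R]_n)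
    (f : 'rV[R]_n -> R) :
  compact K -> continuous f -> (forall x, ~ K x -> f x = 0) ->
  (lebesgue_tuple R n).-integrable setT (EFin \o (f \o @rv_of_tuple R n)).
Proof.
move=> cK cf f0; have [C fC] := compact_support_bounded cK cf f0.
have [M M0 KM] := compact_sub_cube cK.
pose B := [set t : n.-tuple (measurableTypeR R) |
  forall i, ball (0 : R) M (tnth t i)].
have Bfin : (lebesgue_tuple R n B < +oo)%E.
  by rewrite (lebesgue_tuple_cube (fun=> 0) M0) ltry.
apply: (bounded_support_integrable (measurable_cube (fun=> 0) M) Bfin).
- exact: measurable_continuous.
- by move=> t; exact: fC.
- move=> t /= nM; apply: f0 => /= Kt; apply: nM => i.
  by rewrite /ball/= sub0r normrN; exact: KM.
Qed.

Lemma is_derive_line (R : realType) (n : nat) (f : 'rV[R]_n -> R) (i : 'I_n)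
    (x : 'rV[R]_n) (c s : R) :
  (forall x, differentiable f x) ->
  is_derive s (1 : R) (fun s => f (x + (s - c) *: delta_mx ord0 i))
    (partial i f (x + (s - c) *: delta_mx ord0 i)).
Proof.
move=> df; set e := delta_mx ord0 i.
have E : (fun h => h^-1 *: ((fun s => f (x + (s - c) *: e)) (h *: 1 + s) -
      f (x + (s - c) *: e))) =
    (fun h => h^-1 *: (f (h *: e + (x + (s - c) *: e)) - f (x + (s - c) *: e))).
  apply/funext => h; congr (_ *: (f _ - _)).
  by rewrite -[h *: 1]/(h * 1) mulr1 -addrA scalerDl addrCA.
apply: DeriveDef; last by rewrite /partial /derive E.
by rewrite /derivable E; apply: diff_derivable.
Qed.

Lemma rv_of_tuple_update_coord (R : realType) (n : nat) (i : 'I_n)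
    (t : n.-tuple (measurableTypeR R)) (s : R) :
  rv_of_tuple (update_coord i t s) =
  rv_of_tuple t + (s - tnth t i) *: delta_mx ord0 i.
Proof.
apply/rowP => j; rewrite !mxE tnth_mktuple eqxx/=.
by case: eqVneq => [->|_]; rewrite ?mulr1 ?mulr0 ?addr0// addrC subrK.
Qed.

Lemma integral_partial (R : realType) (n : nat) (K : set 'rV[R]_n)
    (f : 'rV[R]_n -> R) (i : 'I_n) :
  compact K -> (forall x, differentiable f x) -> continuous (partial i f) ->
  (forall x, ~ K x -> f x = 0 /\ partial i f x = 0) ->
  (\int[lebesgue_tuple R n]_t (partial i f (rv_of_tuple t))%:E = 0)%E.
Proof.
move=> cK df cdf supp.
have [C fC] := compact_support_bounded cK cdf (fun x Kx => (supp x Kx).2).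
have [M M0 KM] := compact_sub_cube cK.
apply: (@integral_coord_derivative _ _ i (f \o @rv_of_tuple R n)
    (partial i f \o @rv_of_tuple R n) C M M0).
- exact: measurable_continuous.
- by move=> t; exact: fC.
- move=> t j Mj; apply: supp => Kt.
  by have := KM t j Kt; rewrite ltNge Mj.
- move=> t s; have := is_derive_line i (rv_of_tuple t) (tnth t i) s df.
  rewrite /= rv_of_tuple_update_coord; congr is_derive.
  by apply/funext => s' /=; rewrite rv_of_tuple_update_coord.
- move=> t s; rewrite /=; under eq_fun do rewrite rv_of_tuple_update_coord.
  apply: (@continuous_comp _ _ _
    (fun s => rv_of_tuple t + (s - tnth t i) *: delta_mx ord0 i) (partial i f)).
    apply: cvgD; first exact: cvg_cst.
    by apply: cvgZr_tmp; apply: cvgB; [exact: cvg_id|exact: cvg_cst].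
  exact: cdf.
Qed.

(** For a test function [phi], the product [w * phi] has compact support, so its
    partial derivative has integral zero over the whole space; the integrals
    over [Omega] are the same because [phi] vanishes off a compact subset. *)
Lemma weak_gradient_C1 (R : realType) (n : nat) (Omega : set 'rV[R]_n)
    (w : 'rV[R]_n -> R) :
  open Omega -> (forall x, differentiable w x) ->
  (forall i, continuous (partial i w)) ->
  weak_gradient Omega w (grad w).
Proof.
move=> oO dw cdw phi [sphi [K [cK KO phi0]]] i.
have dphi x : differentiable phi x by have := sphi [::] x.
have dphi1 x : differentiable (partial i phi) x by have := sphi [:: i] x.
have phi10 x : ~ K x -> partial i phi x = 0.
  move=> Kx; rewrite /partial.
  have nK : \forall y \near x, phi y = 0.
    have oK : open (~` K) by apply: closed_openC; exact: compact_closed.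
    by apply: filterS (open_nbhs_nbhs (conj oK Kx)) => y; exact: phi0.
  rewrite (@near_eq_derive _ _ _ phi (cst 0))//.
  exact: derive_cst.
have cw : continuous w by move=> x; exact: differentiable_continuous.
have cphi : continuous phi by move=> x; exact: differentiable_continuous.
have cphi1 : continuous (partial i phi).
  by move=> x; exact: differentiable_continuous.
pose f1 : 'rV[R]_n -> R := w \* partial i phi.
pose f2 : 'rV[R]_n -> R := phi \* partial i w.
have cf1 : continuous f1.
  by move=> x; exact: (cvgM (cw x) (cphi1 x)).
have cf2 : continuous f2.
  by move=> x; exact: (cvgM (cphi x) (cdw i x)).
have f10 x : ~ K x -> f1 x = 0 by move=> Kx; rewrite /f1/= phi10// mulr0.
have f20 x : ~ K x -> f2 x = 0 by move=> Kx; rewrite /f2/= phi0// mul0r.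
have i1 := compact_support_integrable cK cf1 f10.
have i2 := compact_support_integrable cK cf2 f20.
have E : partial i (w \* phi) = f1 \+ f2.
  by apply/funext => x; rewrite partialM.
have S0 : (\int[lebesgue_tuple R n]_t ((f1 \+ f2) (rv_of_tuple t))%:E = 0)%E.
  rewrite -E; apply: (integral_partial cK).
  - by move=> x; exact: differentiableM.
  - by rewrite E => x; exact: (cvgD (cf1 x) (cf2 x)).
  - move=> x Kx; rewrite E /=; split; first by rewrite phi0// mulr0.
    by rewrite f10// f20// addr0.
have off (f : 'rV[R]_n -> R) : (forall x, ~ K x -> f x = 0) ->
    \int[lebesgue_tuple R n]_(t in @rv_of_tuple R n @^-1` Omega) f (rv_of_tuple t)
    = \int[lebesgue_tuple R n]_t f (rv_of_tuple t).
  move=> f0; rewrite Rintegral_mkcond; apply: eq_Rintegral => t _.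
  rewrite patchE; case: ifPn => // /negP tO; rewrite f0// => Kt; apply: tO.
  by apply/mem_set; exact: KO.
rewrite (off f1)//.
under [in RHS]eq_Rintegral do rewrite mxE mulrC.
rewrite (off f2)//; apply/eqP; rewrite -addr_eq0.
rewrite -(@RintegralD _ _ _ _ _ (f1 \o @rv_of_tuple R n)
  (f2 \o @rv_of_tuple R n))//.
by apply/eqP; rewrite /Rintegral S0.
Qed.

(** * Smooth competitors *)

Lemma coord_le_enorm (R : realType) (n : nat) (v : 'rV[R]_n) (i : 'I_n) :
  `|v ord0 i| <= enorm v.
Proof.
rewrite -sqrtr_sqr ler_wsqrtr// /dotp (bigD1 i)//= -expr2 lerDl.
by apply: sumr_ge0 => j _; rewrite -expr2 sqr_ge0.
Qed.

Lemma lebesgue_tuple_open_gt0 (R : realType) (n : nat) (U : set 'rV[R]_n) :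
  open U -> U !=set0 -> (0 < lebesgue_tuple R n (@rv_of_tuple R n @^-1` U))%E.
Proof.
move=> oU [x Ux]; have /nbhs_ballP[e /= e0 eU] : nbhs x U.
  exact: open_nbhs_nbhs.
have : (0 < lebesgue_tuple R n (@rv_of_tuple R n @^-1` ball x e))%E.
  rewrite preimage_ballE// (lebesgue_tuple_cube (fun i => x ord0 i) e0).
  by rewrite lte_fin exprn_gt0// pmulrn_lgt0.
move=> /lt_le_trans; apply; apply: le_measure; rewrite ?inE.
- by apply: measurable_rv_of_tuple_open; exact: ball_open.
- exact: measurable_rv_of_tuple_open.
- by move=> t /eU.
Qed.

Lemma Linf_norm_le (R : realType) (n : nat) (Omega : set 'rV[R]_n)
    (f : 'rV[R]_n -> R) (C : R) :
  0 <= C -> (forall x, Omega x -> `|f x| <= C) ->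
  (Linf_norm Omega f <= C%:E)%E.
Proof.
move=> C0 fC; rewrite /Linf_norm unlock; case: ifPn => [_|_]; last first.
  by rewrite lee_fin.
apply/ess_supP; apply: nearW => t; rewrite /= lee_fin patchE.
by case: ifPn => [/set_mem/fC //|_]; rewrite normr0.
Qed.

(** Near [x1] there is a nonempty open part of [Omega], hence a set of positive
    measure, where a continuous [f] exceeds any number below [f x1]. *)
Lemma Linf_norm_ge (R : realType) (n : nat) (Omega : set 'rV[R]_n)
    (f : 'rV[R]_n -> R) (x1 : 'rV[R]_n) :
  open Omega -> continuous f -> closure Omega x1 ->
  ((f x1)%:E <= Linf_norm Omega f)%E.
Proof.
move=> oO cf cx1; rewrite /Linf_norm unlock.
rewrite -[X in (0 < _ X)%E]/(@rv_of_tuple R n @^-1` setT).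
rewrite lebesgue_tuple_open_gt0; [|exact: openT|by exists x1].
rewrite leNgt; apply/negP; set L := ess_sup _ _ => Lf.
have [c Lc cf1] : exists2 c : R, (L <= c%:E)%E & c < f x1.
  move: Lf; case: L => [r|//|_]; first by rewrite lte_fin; exists r.
  by exists (f x1 - 1); [rewrite leNye|rewrite gtrBl].
pose U := Omega `&` f @^-1` [set r | c < r].
have oU : open U.
  by apply: openI => //; apply: open_comp => [x _|]; [exact: cf|exact: open_gt].
have U0 : U !=set0.
  have [x [Ox cx]] := cx1 _ (cf x1 _ (lt_nbhsr cf1)).
  by exists x.
have := lebesgue_tuple_open_gt0 oU U0.
move/ess_supP : Lc => -[N [mN N0 sub]].
rewrite (subset_measure0 (measurable_rv_of_tuple_open oU) mN _ N0) ?ltxx//.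
move=> t [Ot /= ct]; apply: sub => /=; rewrite patchE mem_set// lee_fin.
by apply/negP; rewrite -ltNge (lt_le_trans ct)// ler_norm.
Qed.

Lemma hausdorff_null0 (R : realType) (n k : nat) :
  (0 < k)%N -> hausdorff_null k (set0 : set 'rV[R]_n).
Proof.
move=> k0 eps eps0; pose m := Num.min eps 1.
have m0 : 0 < m by rewrite lt_min eps0 ltr01.
pose r (j : nat) : R := m / (2 ^ j.+1)%:R.
have r0 j : 0 < r j by rewrite divr_gt0// ltr0n expn_gt0.
have r1 j : r j <= 1.
  rewrite ler_pdivrMr ?ltr0n ?expn_gt0// mul1r.
  by rewrite (@le_trans _ _ 1)// ?ge_min ?lexx ?orbT// ler1n expn_gt0.
exists (fun=> 0), r; split=> //.
apply: (@le_trans _ _ (\sum_(0 <= j <oo) (r j)%:E)%E).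
  apply: lee_nneseries => [j _ _|j _].
    by rewrite lee_fin exprn_ge0// ltW.
  rewrite lee_fin; case: k k0 => // k _.
  by rewrite exprS ger_pMr// exprn_ile1// ltW.
apply: (@le_trans _ _ m%:E); first by apply: epsilon_trick0; exact: ltW.
by rewrite lee_fin ge_min lexx.
Qed.

Lemma Lambda_infty_le_C1 (R : realType) (n : nat) (Omega : set 'rV[R]_n)
    (beta m : R) (w : 'rV[R]_n -> R) (x1 : 'rV[R]_n) :
  (2 <= n)%N -> open Omega -> 0 < beta -> 0 <= m ->
  (forall x, differentiable w x) -> (forall i, continuous (partial i w)) ->
  closure Omega x1 -> w x1 = 1 -> (forall x, Omega x -> `|w x| <= 1) ->
  (forall x, Omega x -> enorm (grad w x) <= m) ->
  (forall x, bdry Omega x -> beta * `|w x| <= m) ->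
  (Lambda_infty Omega beta <= m%:E)%E.
Proof.
move=> n2 oO b0 m0 dw cdw cx1 wx1 w1 gm bm.
have cw : continuous w by move=> x; exact: differentiable_continuous.
have mO := measurable_rv_of_tuple_open oO.
have wN : Linf_norm Omega w = 1%E.
  apply/le_anti/andP; split; first exact: Linf_norm_le.
  by rewrite -wx1; exact: Linf_norm_ge.
have gN : (Linf_norm Omega (fun x => enorm (grad w x)) <= m%:E)%E.
  by apply: Linf_norm_le => // x Ox; rewrite ger0_norm ?gm// sqrtr_ge0.
have bN : (Linf_norm_bdry Omega w <= (m / beta)%:E)%E.
  apply: ereal_inf_lbound; exists set0.
    by apply: hausdorff_null0; rewrite -subn1 subn_gt0.
  by move=> x Bx _; rewrite lee_fin ler_pdivlMr// mulrC bm.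
have W : W1inf Omega w (grad w).
  split; last exact: weak_gradient_C1.
  - split; last by rewrite wN ltry.
    exact: (measurable_funTS (measurable_continuous cw)).
  - move=> i; split.
      apply: measurable_funTS.
      under eq_fun do rewrite mxE.
      exact: measurable_continuous.
    apply: (@le_lt_trans _ _ m%:E); last exact: ltry.
    apply: Linf_norm_le => // x Ox.
    exact: le_trans (coord_le_enorm _ _) (gm _ Ox).
apply: (@le_trans _ _ (maxe (Linf_norm Omega (fun x => enorm (grad w x)))
    (beta%:E * Linf_norm_bdry Omega w)%E)).
  apply: ereal_inf_lbound; exists w, (grad w); split=> //.
  exact: continuous_subspaceT.
rewrite ge_max gN/=.
apply: (@le_trans _ _ (beta%:E * (m / beta)%:E)%E).
  by rewrite lee_pmul2l.
by rewrite -EFinM mulrCA mulfV ?mulr1// gt_eqF.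
Qed.

(** * The rounded truncated cone *)

(** A smooth substitute for [max x 0]: the mean of [x] and of the smoothed
    absolute value [sqrt (k ^+ 2 + x ^+ 2)]. *)
Definition softplus (R : realType) (k x : R) : R :=
  (x + Num.sqrt (k ^+ 2 + x ^+ 2)) / 2.

Lemma norm_le_sqrt (R : realType) (k x : R) : `|x| <= Num.sqrt (k ^+ 2 + x ^+ 2).
Proof. by rewrite -sqrtr_sqr ler_wsqrtr// lerDr sqr_ge0. Qed.

Lemma sqrt_le_add (R : realType) (k x : R) : 0 <= k ->
  Num.sqrt (k ^+ 2 + x ^+ 2) <= k + `|x|.
Proof.
move=> k0; have kx : 0 <= k + `|x| by rewrite addr_ge0.
rewrite -[leRHS](ger0_norm kx) -sqrtr_sqr ler_wsqrtr//.
have := mulr_ge0 k0 (normr_ge0 x).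
rewrite sqrrD real_normK ?num_real//; lra.
Qed.

Lemma softplus_ge (R : realType) (k x : R) : 0 <= softplus k x /\ x <= softplus k x.
Proof.
have := norm_le_sqrt k x; rewrite /softplus.
by rewrite ler_norml => /andP[]; split; lra.
Qed.

Lemma softplus_le (R : realType) (k x : R) : 0 <= k -> x <= k ->
  softplus k x <= 2 * k.
Proof.
move=> k0 xk; have := sqrt_le_add x k0; rewrite /softplus.
by have [x0|x0] := ger0P x; lra.
Qed.

Lemma softplus_mono (R : realType) (k x y : R) : x <= y ->
  softplus k x <= softplus k y.
Proof.
move=> xy; rewrite /softplus ler_pM2r ?invr_gt0//.
set S := Num.sqrt (k ^+ 2 + y ^+ 2).
suff : Num.sqrt (k ^+ 2 + x ^+ 2) <= S + (y - x) by lra.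
have S0 : 0 <= S + (y - x) by rewrite addr_ge0 ?sqrtr_ge0// subr_ge0.
have S2 : S ^+ 2 = k ^+ 2 + y ^+ 2 by rewrite sqr_sqrtr// addr_ge0 ?sqr_ge0.
rewrite -[leRHS](ger0_norm S0) -sqrtr_sqr ler_wsqrtr//.
have : 0 <= (y - x) * (S + y).
  rewrite mulr_ge0 ?subr_ge0//; have := norm_le_sqrt k y; rewrite -/S.
  by rewrite ler_norml => /andP[]; lra.
rewrite sqrrD S2; lra.
Qed.

Definition softplus' (R : realType) (k x : R) : R :=
  (1 + x / Num.sqrt (k ^+ 2 + x ^+ 2)) / 2.

Lemma sqrt_gt0 (R : realType) (k x : R) : 0 < k -> 0 < Num.sqrt (k ^+ 2 + x ^+ 2).
Proof. by move=> k0; rewrite sqrtr_gt0 ltr_pwDl ?sqr_ge0// exprn_gt0. Qed.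

Lemma softplus'_bound (R : realType) (k x : R) : 0 < k ->
  0 <= softplus' k x <= 1.
Proof.
move=> k0; have S0 := sqrt_gt0 x k0; have := norm_le_sqrt k x.
rewrite ler_norml => /andP[Sx xS]; rewrite /softplus'.
have h1 : x / Num.sqrt (k ^+ 2 + x ^+ 2) <= 1 by rewrite ler_pdivrMr// mul1r.
have h2 : -1 <= x / Num.sqrt (k ^+ 2 + x ^+ 2) by rewrite ler_pdivlMr// mulN1r.
by apply/andP; split; lra.
Qed.

Lemma is_derive_continuous (R : realType) (f : R -> R) (s v : R) :
  is_derive s 1 f v -> f x @[x --> s] --> f s.
Proof. by case=> /derivable1_diffP/differentiable_continuous. Qed.

Lemma is_derive_sqrt_sqr (R : realType) (k x : R) : 0 < k ->
  is_derive x 1 (fun x : R => Num.sqrt (k ^+ 2 + x ^+ 2))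
    (x / Num.sqrt (k ^+ 2 + x ^+ 2)).
Proof.
move=> k0; have S0 := sqrt_gt0 x k0.
have kx : 0 < k ^+ 2 + x ^+ 2 by rewrite -sqrtr_gt0.
have d2 : is_derive x (1 : R) (fun x : R => x ^+ 2) (2 * x).
  have d := is_deriveM (is_derive_id x (1 : R)) (is_derive_id x (1 : R)).
  have -> : (fun x : R => x ^+ 2) = id * id by apply/funext => y; rewrite expr2.
  apply: (@is_derive_eq _ _ _ _ _ _ _ _ d).
  by rewrite -[_ *: _]/(x * 1) mulr1 -mulr2n mulr_natl.
have dd := @is_derive1_comp _ (fun s => Num.sqrt (k ^+ 2 + s)) (fun x => x ^+ 2)
  _ _ _ (is_derive_sqrt_shift kx) d2.
apply: (@is_derive_eq _ _ _ _ _ _ _ _ dd).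
by rewrite invfM mulrACA mulVf// mul1r mulrC.
Qed.

Lemma is_derive_softplus (R : realType) (k x : R) : 0 < k ->
  is_derive x 1 (softplus k) (softplus' k x).
Proof.
move=> k0; have dS := is_derive_sqrt_sqr x k0.
have d := is_deriveZ (2^-1) (is_deriveD (is_derive_id x (1 : R)) dS).
have -> : softplus k = 2^-1 \*: (id + (fun x : R => Num.sqrt (k ^+ 2 + x ^+ 2))).
  by apply/funext => y; rewrite /softplus mulrC.
by apply: (@is_derive_eq _ _ _ _ _ _ _ _ d); rewrite /softplus' [RHS]mulrC.
Qed.

Lemma continuous_softplus' (R : realType) (k : R) : 0 < k ->
  continuous (softplus' k).
Proof.
move=> k0 x.
have cS := is_derive_continuous (is_derive_sqrt_sqr x k0).
have S0 := lt0r_neq0 (sqrt_gt0 x k0).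
exact: (cvgM (cvgD (cvg_cst (1 : R)) (cvgM (@cvg_id _ (nbhs x)) (cvgV S0 cS)))
  (cvg_cst (2^-1 : R))).
Qed.

(** The truncated cone with vertex [x1] and radius [d], both singularities being
    rounded at scale [t].  The shift [d + t] compensates for the value [t] of
    the rounded distance at [x1], so that the function equals 1 there. *)
Definition competitor (R : realType) (n : nat) (beta d t : R)
    (x1 x : 'rV[R]_n) : R :=
  (beta^-1 + softplus t (d + t - Num.sqrt (t ^+ 2 + sqdist x1 x))) /
  (beta^-1 + softplus t d).

Lemma competitor_grad (R : realType) (n : nat) (beta d t : R) (x1 : 'rV[R]_n) :
  0 < beta -> 0 <= d -> 0 < t ->
  (forall x, differentiable (competitor beta d t x1) x) /\
  ((forall i, continuous (partial i (competitor beta d t x1))) /\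
  (forall x, enorm (grad (competitor beta d t x1) x) <= (beta^-1 + d)^-1)).
Proof.
move=> b0 d0 t0; set N := beta^-1 + softplus t d.
have ib : 0 < beta^-1 by rewrite invr_gt0.
have [P0 Pd] := softplus_ge t d.
have N0 : 0 < N by rewrite ltr_pwDl.
have t20 : 0 < t ^+ 2 by rewrite exprn_gt0.
pose q (s : R) := Num.sqrt (t ^+ 2 + s).
pose h (s : R) := (beta^-1 + softplus t (d + t - q s)) / N.
pose h1 (s : R) := - (softplus' t (d + t - q s) * (2 * q s)^-1 / N).
have ts (s : R) : 0 <= s -> 0 < t ^+ 2 + s by move=> s0; rewrite ltr_pwDl.
have dq (s : R) (s0 : 0 <= s) := is_derive_sqrt_shift (ts s s0).
have dh (s : R) : 0 <= s -> is_derive s 1 h (h1 s).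
  move=> s0; have dd := is_deriveB (is_derive_cst (d + t) s (1 : R)) (dq s s0).
  have dP := @is_derive1_comp _ (softplus t) _ _ _ _ (is_derive_softplus _ t0) dd.
  have de := is_deriveZ (N^-1) (is_deriveD (is_derive_cst beta^-1 s (1 : R)) dP).
  have -> : h = N^-1 \*: (cst beta^-1 + softplus t \o (cst (d + t) - q)).
    by apply/funext => y; rewrite /h mulrC.
  apply: (@is_derive_eq _ _ _ _ _ _ _ _ de).
  rewrite add0r sub0r mulrN scalerN; congr (- _); exact: mulrC.
have ch1 (s : R) : 0 <= s -> h1 y @[y --> s] --> h1 s.
  move=> s0; have cq := is_derive_continuous (dq s s0).
  have q0 : 2 * q s != 0.
    by rewrite mulf_neq0 ?pnatr_eq0// gt_eqF// sqrtr_gt0 ts.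
  have cP : softplus' t (d + t - q y) @[y --> s] --> softplus' t (d + t - q s).
    apply: continuous_cvg; first exact: continuous_softplus'.
    exact: (cvgB (cvg_cst (d + t)) cq).
  exact: (cvgN (cvgM (cvgM cP
    (cvgV q0 (cvgM (cvg_cst (2 : R)) cq))) (cvg_cst N^-1))).
have [D P] := radial_partial x1 dh.
split=> //; split=> [i x|x].
  rewrite -[competitor _ _ _ _]/(h \o sqdist x1) P.
  have cs : sqdist x1 y @[y --> x] --> sqdist x1 x by exact: continuous_sqdist.
  have c1 : h1 (sqdist x1 y) @[y --> x] --> h1 (sqdist x1 x).
    by apply: continuous_cvg cs; exact: (ch1 _ (sqdist_ge0 x1 x)).
  have c2 : 2 * (y ord0 i - x1 ord0 i) @[y --> x] --> 2 * (x ord0 i - x1 ord0 i).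
    have [/differentiable_continuous c _] := partial_coord i i (x1 ord0 i) x.
    exact: (cvgM (cvg_cst (2 : R)) c).
  exact: (cvgM c1 c2).
have -> : grad (competitor beta d t x1) x = (2 * h1 (sqdist x1 x)) *: (x - x1).
  apply/rowP => i; rewrite !mxE -[competitor _ _ _ _]/(h \o sqdist x1) P /=.
  by ring.
rewrite enormZ enorm_sqrt; set s := sqdist x1 x.
have s0 : 0 <= s by exact: sqdist_ge0.
have q0 : 0 < q s by rewrite sqrtr_gt0 ts.
have sq : Num.sqrt s <= q s by rewrite ler_wsqrtr// lerDr ltW.
set p := softplus' t (d + t - q s).
have /andP[p0 p1] : 0 <= p <= 1 by exact: softplus'_bound.
have -> : 2 * h1 s = - (p * (q s)^-1 * N^-1).
  by rewrite /h1 -/p; field; rewrite !gt_eqF.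
have pqN : 0 <= p * (q s)^-1 * N^-1.
  by apply: mulr_ge0; [apply: mulr_ge0 => //|]; rewrite invr_ge0 ltW.
rewrite normrN (ger0_norm pqN).
apply: (@le_trans _ _ N^-1); last first.
  by rewrite lef_pV2 ?posrE// ?ltr_pwDl// lerD2l.
rewrite mulrAC ger_pMl ?invr_gt0// -mulrA mulr_ile1//.
  by rewrite mulr_ge0 ?invr_ge0 ?sqrtr_ge0// ltW.
by rewrite mulrC ler_pdivrMr// mul1r.
Qed.

(** On the boundary the rounded distance is at least [d], so the argument of
    [softplus] is at most [t] and the competitor at most
    [(1 / beta + 2 * t) / (1 / beta + d)].  The scale [t] is chosen so that
    [beta] times this bound is exactly [1 / (1 / beta + d) + e]. *)
Lemma Lambda_infty_le_radius (R : realType) (n : nat) (Omega : set 'rV[R]_n)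
    (beta d : R) (x1 : 'rV[R]_n) :
  (2 <= n)%N -> open Omega -> 0 < beta -> 0 <= d ->
  closure Omega x1 -> (forall y, bdry Omega y -> d <= enorm (x1 - y)) ->
  (Lambda_infty Omega beta <= ((beta^-1 + d)^-1)%:E)%E.
Proof.
move=> n2 oO b0 d0 cx1 bd.
have ib : 0 < beta^-1 by rewrite invr_gt0.
have bd0 : 0 < beta^-1 + d by rewrite ltr_pwDl.
apply/lee_addgt0Pr => e e0.
pose t := e / beta * (beta^-1 + d) / 2.
have t0 : 0 < t by rewrite !(mulr_gt0, divr_gt0).
have [D [cD gD]] := competitor_grad x1 b0 d0 t0.
have [P0 Pd] := softplus_ge t d.
set w := competitor beta d t x1 in D cD gD.
set N := beta^-1 + softplus t d.
have N0 : 0 < N by rewrite ltr_pwDl.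
have w0 x : 0 <= w x.
  by rewrite divr_ge0 ?(ltW N0)// addr_ge0 ?(ltW ib)// (softplus_ge _ _).1.
have qt x : t <= Num.sqrt (t ^+ 2 + sqdist x1 x).
  by rewrite -[leLHS](gtr0_norm t0) -sqrtr_sqr ler_wsqrtr// lerDl sqdist_ge0.
rewrite -EFinD; apply: (@Lambda_infty_le_C1 _ _ _ _ _ w x1) => //.
- by rewrite addr_ge0 ?invr_ge0 ?ltW.
- have /eqP s0 : sqdist x1 x1 == 0 by rewrite sqdist_eq0.
  rewrite /w /competitor s0 addr0 sqrtr_sqr gtr0_norm// addrK mulfV//.
  by rewrite gt_eqF.
- move=> x _; rewrite ger0_norm// ler_pdivrMr// mul1r lerD2l.
  by apply: softplus_mono; have := qt x; lra.
- by move=> x _; rewrite (le_trans (gD x))// lerDl ltW.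
- move=> x bx; rewrite ger0_norm//.
  have dx : d <= Num.sqrt (t ^+ 2 + sqdist x1 x).
    rewrite (le_trans (bd x bx))// -[X in X <= _]/(Num.sqrt (sqdist x x1)).
    rewrite (_ : sqdist x x1 = sqdist x1 x).
      by rewrite ler_wsqrtr// lerDr sqr_ge0.
    by rewrite /sqdist -opprB -scaleN1r dotpZ dotpZr !mulN1r opprK.
  have wx : w x <= (beta^-1 + 2 * t) / N.
    rewrite ler_pM2r ?invr_gt0// lerD2l; apply: softplus_le; first exact: ltW.
    by move: dx; lra.
  apply: (@le_trans _ _ (beta * ((beta^-1 + 2 * t) / (beta^-1 + d)))).
    rewrite ler_pM2l// (le_trans wx)// ler_pM2l.
      by rewrite lef_pV2 ?posrE// lerD2l.
    by rewrite addr_gt0// mulr_gt0.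
  rewrite le_eqVlt; apply/orP; left; apply/eqP; rewrite /t.
  move: bd0; set c := beta^-1 + d => c0.
  by field; rewrite !gt_eqF.
Qed.

(** * Conclusion *)

(** The hypothesis on [n] excludes the one-point space. *)
Lemma exists_exterior (R : realType) (n : nat) (A : set 'rV[R]_n) :
  (0 < n)%N -> bounded_set A -> exists y, ~ A y.
Proof.
case: n A => // n A _ [M [_ bA]]; exists (const_mx (`|M| + 2)) => /bA.
move=> /(_ (`|M| + 1)); rewrite ltr_pwDr ?ler_norm// => /(_ isT).
apply/negP; rewrite -ltNge.
have MM : `|M| + 1 < `|M| + 2 by rewrite ltrD2l ltr1n.
apply: lt_le_trans MM _.
rewrite -[X in _ <= X]/(mx_norm _) mx_normrE.
apply: le_trans (le_bigmax _ _ (ord0, ord0)) => /=.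
by rewrite mxE ler_norm.
Qed.

Unset Implicit Arguments.

Theorem theorem3p6 (R : realType) (n : nat) (hn : (2 <= n)%N)
  (Omega : set 'rV[R]_n) (hopen : open Omega) (hbdd : bounded_set Omega)
  (hC2 : class_C2 Omega)
  (nu : 'rV[R]_n -> 'rV[R]_n) (hnu : outer_unit_normal Omega nu)
  (beta : R) (hbeta : 0 < beta)
  (Lambda : R) (u : 'rV[R]_n -> R)
  (hu : viscosity_solution Omega (eigen_F Lambda) (robin_B nu beta) u)
  (hu_nontrivial : positive_somewhere (closure Omega) u) :
  (Lambda_infty Omega beta <= Lambda%:E)%E.
Proof.
case: hu => cu _ su; case: hu_nontrivial => x0 cx0 ux0.
have compO : compact (closure Omega).
  apply: bounded_closed_compact; last exact: closed_closure.
  exact: bounded_closure.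
have [x1 /set_mem cx1 maxu] := EVT_max_rV (ex_intro _ x0 cx0) compO cu.
have {}maxu x : closure Omega x -> u x <= u x1 by move=> /mem_set /maxu.
have ux1 : 0 < u x1 := lt_le_trans ux0 (maxu _ cx0).
set L := Num.max Lambda 0.
have bound y : ~ closure Omega y -> 1 <= L * (beta^-1 + enorm (x1 - y)).
  exact: exterior_distance_bound hopen hbdd hbeta cu su cx1 maxu ux1.
have [y0 ey0] := exists_exterior (ltnW hn) (bounded_closure hbdd).
have ib : 0 < beta^-1 by rewrite invr_gt0.
have L0 : 0 < L.
  rewrite lt_def le_max lexx orbT andbT; apply/eqP => L0.
  by have := bound _ ey0; rewrite L0 mul0r ler10.
have LE : L = Lambda.
  by move: L0; rewrite /L; have [_|//] := leP Lambda 0; rewrite ltxx.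
pose E := [set enorm (x1 - y) | y in ~` closure Omega].
have E0 : E !=set0 by exists (enorm (x1 - y0)); exists y0.
have lbE0 : lbound E 0 by move=> _ [y _ <-]; exact: sqrtr_ge0.
have hE : has_lbound E by exists 0.
have d0 : 0 <= inf E by exact: lb_le_inf.
have dL : L^-1 - beta^-1 <= inf E.
  apply: lb_le_inf => // _ [y ey <-].
  by rewrite lerBlDl -div1r ler_pdivrMr// mulrC; exact: bound.
apply: (@le_trans _ _ ((beta^-1 + inf E)^-1)%:E).
  apply: (@Lambda_infty_le_radius _ _ _ _ _ x1) => // y by_.
  have cd : closed [set y | inf E <= enorm (x1 - y)].
    have -> : [set y | inf E <= enorm (x1 - y)] =
        (fun y : 'rV[R]_n => enorm (y - x1)) @^-1` [set r | inf E <= r].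
      by apply/funext => z; rewrite /= -opprB -scaleN1r enormZ normrN1 mul1r.
    apply: (@preimage_closed _ _ _ _ _ (@closed_ge _ _)) => z _.
    exact: continuous_dist.
  suff : closure [set y | inf E <= enorm (x1 - y)] y.
    by rewrite -((closure_id _).1 cd).
  move: (bdry_limit_of_exterior hopen hC2 by_).
  by apply: closureS => z ez; apply: inf_lbound => //; exists z.
rewrite lee_fin -LE -[leRHS]invrK lef_pV2 ?posrE ?invr_gt0// ?ltr_pwDl//.
by rewrite addrC -lerBlDr.
Qed.
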